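(* Let $K\ge 1$ and let $f=h+\overline{g}$ (with $h,g$ analytic in $\mathbb{D}$) be a harmonic $K$-quasiregular mapping defined on the unit disc $\mathbb{D}$ such that $f(0)=0$, $J_f(0)=1$ and $\lambda_f(z)\le\lambda$ for all $z\in\mathbb{D}$, where $\lambda$ is a constant. Then $f$ is univalent on the disc $\mathbb{D}_{\rho}$ with $$\rho=\rho(\lambda)=\frac{1}{1+\lambda K^{3/2}},$$ and $f(\mathbb{D}_{\rho})$ contains a schlicht disc with radius $$R(\lambda)=\frac{\rho(\lambda)}{\sqrt{K}}+K\lambda\left(\rho(\lambda)+\ln\left(\lambda K^{3/2}\rho(\lambda)\right)\right).$$
   Context: $\mathbb{D}=\{z\in\mathbb{C}:|z|<1\}$ and $\mathbb{D}_r=\{z\in\mathbb{C}:|z|<r\}$. Univalent means one-to-one. A schlicht disc in the image of a region under $f$ is an open disc that is the one-to-one image under $f$ of some subdomain of that region. A complex-valued function $f=u+iv$ is harmonic if $u$ and $v$ are real-valued harmonic functions. For a continuously differentiable $f$, put $\Lambda_f=|f_z|+|f_{\bar z}|$, $\lambda_f=\big||f_z|-|f_{\bar z}|\big|$, and $J_f=|f_z|^2-|f_{\bar z}|^2$ (the Jacobian). A harmonic function $f$ is sense-preserving if $J_f(z)>0$ in its domain. A sense-preserving harmonic mapping $f$ on $\mathbb{D}$ is $K$-quasiregular ($K\ge1$) if $\Lambda_f^2\le K J_f$, equivalently $\Lambda_f\le K\lambda_f$, everywhere on $\mathbb{D}$. *)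

(* Defs.v *)
From Stdlib Require Import Reals.
From Coquelicot Require Import Coquelicot.
Open Scope R_scope.

(** Discs are written with [Cmod]: Coquelicot's [ball] on [C] is a square
    (it comes from the product uniform structure); the topology is the same. *)
Definition open_disc (a : C) (r : R) (z : C) : Prop := Cmod (z - a)%C < r.

Definition connected_set (S : C -> Prop) : Prop :=
  forall U V : C -> Prop,
    open U -> open V ->
    (forall z, S z -> U z \/ V z) ->
    (exists z, S z /\ U z) ->
    (exists z, S z /\ V z) ->
    exists z, S z /\ U z /\ V z.

Definition is_domain (S : C -> Prop) : Prop :=
  open S /\ connected_set S /\ exists z, S z.

Definition univalent_on (S : C -> Prop) (f : C -> C) : Prop :=
  forall z w, S z -> S w -> f z = f w -> z = w.

(** The image under [f] of the region [S] contains a schlicht disc of radius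
    [r].  Since subdomains are nonempty, this forces [0 < r]. *)
Definition has_schlicht_disc (S : C -> Prop) (f : C -> C) (r : R) : Prop :=
  exists (a : C) (T : C -> Prop),
    is_domain T /\
    (forall z, T z -> S z) /\
    univalent_on T f /\
    (forall w, open_disc a r w <-> exists z, T z /\ f z = w).

Definition analytic_on (S : C -> Prop) (h : C -> C) : Prop :=
  forall z, S z -> @ex_derive C_AbsRing C_NormedModule h z.

(** [ex_diff_n u 2] at every point of an open set means [u] is C^2 there. *)
Definition real_harmonic_on (S : C -> Prop) (u : R -> R -> R) : Prop :=
  forall x y, S (x, y) ->
    ex_diff_n u 2 x y /\
    partial_derive 2 0 u x y + partial_derive 0 2 u x y = 0.

Definition harmonic_on (S : C -> Prop) (f : C -> C) : Prop :=
  real_harmonic_on S (fun x y => Re (f (x, y))) /\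
  real_harmonic_on S (fun x y => Im (f (x, y))).

Definition d_x (f : C -> C) (z : C) : C :=
  (Derive (fun t => Re (f (t, Im z))) (Re z),
   Derive (fun t => Im (f (t, Im z))) (Re z)).

Definition d_y (f : C -> C) (z : C) : C :=
  (Derive (fun t => Re (f (Re z, t))) (Im z),
   Derive (fun t => Im (f (Re z, t))) (Im z)).

(** Wirtinger derivatives f_z and f_{\bar z}. *)
Definition d_z (f : C -> C) (z : C) : C := ((d_x f z - Ci * d_y f z) / 2)%C.
Definition d_zbar (f : C -> C) (z : C) : C := ((d_x f z + Ci * d_y f z) / 2)%C.

Definition Lambda_ (f : C -> C) (z : C) : R :=
  Cmod (d_z f z) + Cmod (d_zbar f z).

Definition lambda_ (f : C -> C) (z : C) : R :=
  Rabs (Cmod (d_z f z) - Cmod (d_zbar f z)).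

Definition J_ (f : C -> C) (z : C) : R :=
  Cmod (d_z f z) ^ 2 - Cmod (d_zbar f z) ^ 2.

Definition sense_preserving_harmonic_on (S : C -> Prop) (f : C -> C) : Prop :=
  harmonic_on S f /\ forall z, S z -> 0 < J_ f z.

Definition harmonic_quasiregular_on
    (S : C -> Prop) (K : R) (f : C -> C) : Prop :=
  sense_preserving_harmonic_on S f /\
  forall z, S z -> Lambda_ f z ^ 2 <= K * J_ f z.

(* Main.v *)
Require Import Defs.
From Stdlib Require Import Reals Lra Lia ClassicalEpsilon.
From Coquelicot Require Import Coquelicot.
Open Scope R_scope.

(** Write [p = f_z], [q = f_zbar], [M = K lam] and let [L] be the differential
    of [f] at [0].  Harmonicity of [f] says that [p] and the conjugate of [q] are
    holomorphic, so for unimodular [c], [d] the function [c p + d (conj q)] is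
    holomorphic and bounded by [Lambda_f <= M].  Cauchy's estimate for its
    derivative gives [|p z - p 0| + |q z - q 0| <= M |z| / (1 - |z|)].  On the
    other hand [J_f 0 = 1] and quasiregularity give [lambda_f 0 >= 1 / sqrt K],
    so that [L] expands distances by at least [1 / sqrt K].  The radius [rho] is
    where [M r / (1 - r) = 1 / sqrt K]: inside it, [f] is [L] plus a map whose
    local Lipschitz constant is smaller than the expansion factor of [L], hence
    injective.  The radius [R] is the integral of [1 / sqrt K - M r / (1 - r)]
    over [[0, rho]], and the disc is reached by solving [f z = w] as a fixed
    point equation. *)

(** * Calculus of complex-valued curves *)

(** Working in real coordinates lets the real mean value theorem and real Riemann integrals apply to
    complex curves. *)
Definition cderive (phi : R -> C) (t : R) (l : C) : Prop :=
  is_derive (fun s => Re (phi s)) t (Re l) /\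
  is_derive (fun s => Im (phi s)) t (Im l).

Lemma cderive_eq (phi : R -> C) (t : R) (l m : C) :
  cderive phi t l -> l = m -> cderive phi t m.
Proof. now intros H <-. Qed.

Lemma cderive_const (c : C) (t : R) : cderive (fun _ => c) t (RtoC 0).
Proof.
split; simpl; apply is_derive_Reals, derivable_pt_lim_const.
Qed.

Lemma cderive_plus (phi psi : R -> C) (t : R) (l m : C) :
  cderive phi t l -> cderive psi t m ->
  cderive (fun s => (phi s + psi s)%C) t (l + m)%C.
Proof.
intros [H1 H2] [H3 H4].
split; simpl; [exact (is_derive_plus _ _ _ _ _ H1 H3)
  | exact (is_derive_plus _ _ _ _ _ H2 H4)].
Qed.

Lemma cderive_conj (phi : R -> C) (t : R) (l : C) :
  cderive phi t l -> cderive (fun s => Cconj (phi s)) t (Cconj l).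
Proof.
intros [H1 H2].
split; simpl; [exact H1 | exact (is_derive_opp _ _ _ H2)].
Qed.

Lemma cderive_mult (phi psi : R -> C) (t : R) (l m : C) :
  cderive phi t l -> cderive psi t m ->
  cderive (fun s => (phi s * psi s)%C) t (l * psi t + phi t * m)%C.
Proof.
intros [H1 H2] [H3 H4].
split; simpl; unfold Re, Im in *.
- evar_last.
  + apply (is_derive_minus (fun s => fst (phi s) * fst (psi s))
      (fun s => snd (phi s) * snd (psi s)));
    apply (is_derive_mult (K := R_AbsRing)); eauto; intros; apply Rmult_comm.
  + unfold minus, plus, opp, mult; simpl; ring.
- evar_last.
  + apply (is_derive_plus (fun s => fst (phi s) * snd (psi s))
      (fun s => snd (phi s) * fst (psi s)));
    apply (is_derive_mult (K := R_AbsRing)); eauto; intros; apply Rmult_comm.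
  + unfold minus, plus, opp, mult; simpl; ring.
Qed.

Lemma cderive_scal (c : C) (phi : R -> C) (t : R) (l : C) :
  cderive phi t l -> cderive (fun s => (c * phi s)%C) t (c * l)%C.
Proof.
intros H.
replace (c * l)%C with (RtoC 0 * phi t + c * l)%C by ring.
exact (cderive_mult _ _ _ _ _ (cderive_const c t) H).
Qed.

Lemma cderive_minus (phi psi : R -> C) (t : R) (l m : C) :
  cderive phi t l -> cderive psi t m ->
  cderive (fun s => (phi s - psi s)%C) t (l - m)%C.
Proof.
intros [H1 H2] [H3 H4].
split; simpl; [exact (is_derive_minus _ _ _ _ _ H1 H3)
  | exact (is_derive_minus _ _ _ _ _ H2 H4)].
Qed.

Lemma cderive_RtoC (t : R) : cderive RtoC t (RtoC 1).
Proof.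
split; simpl; [exact (is_derive_id t) | apply is_derive_Reals, derivable_pt_lim_const].
Qed.

Lemma cderive_line (a w : C) (t : R) : cderive (fun s => (a + RtoC s * w)%C) t w.
Proof.
apply (cderive_eq _ _ (RtoC 0 + (RtoC 1 * w + RtoC t * RtoC 0))%C); [|ring].
apply cderive_plus; [apply cderive_const|].
apply cderive_mult; [apply cderive_RtoC | apply cderive_const].
Qed.

Definition cis (t : R) : C := (cos t, sin t).

Lemma cderive_cis (t : R) : cderive cis t (Ci * cis t)%C.
Proof.
split; simpl; auto_derive; auto; ring.
Qed.

Lemma cis_conj (t : R) : (cis t * Cconj (cis t))%C = RtoC 1.
Proof.
unfold cis, Cconj, Cmult, RtoC; simpl.
generalize (sin2_cos2 t); unfold Rsqr; intros H; f_equal; lra.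
Qed.

Lemma Cmod_cis (t : R) : Cmod (cis t) = 1.
Proof.
unfold cis, Cmod; simpl.
replace (_ + _) with 1; [apply sqrt_1|].
generalize (sin2_cos2 t); unfold Rsqr; lra.
Qed.

(** * Wirtinger derivatives *)

(** [F] is real-differentiable at [z] with Wirtinger derivatives [p], [q];
    it is tested along differentiable curves, which makes sums, products and
    chain rules immediate. *)
Definition wirtinger (F : C -> C) (z p q : C) : Prop :=
  forall (gam : R -> C) (t : R) (w : C),
    gam t = z -> cderive gam t w ->
    cderive (fun s => F (gam s)) t (p * w + q * Cconj w)%C.

Definition cauchy_riemann (F : C -> C) (z p : C) : Prop := wirtinger F z p (RtoC 0).

(** This is the chain rule in two real variables. The two pairs are $(F_x-iF_y)/2$ and
    $(F_x+iF_y)/2$ in coordinates, where $F_x=(u_x,v_x)$ and $F_y=(u_y,v_y)$. *)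
Lemma wirtinger_intro (F : C -> C) (x y ux uy vx vy : R) :
  differentiable_pt_lim (fun x y => Re (F (x, y))) x y ux uy ->
  differentiable_pt_lim (fun x y => Im (F (x, y))) x y vx vy ->
  wirtinger F (x, y) ((ux + vy) / 2, (vx - uy) / 2) ((ux - vy) / 2, (vx + uy) / 2).
Proof.
intros Hu Hv gam t w Hz [H1 H2].
assert (E1 : Re (gam t) = x) by now rewrite Hz.
assert (E2 : Im (gam t) = y) by now rewrite Hz.
rewrite <- E1, <- E2 in Hu, Hv.
assert (Eta : forall s, gam s = (Re (gam s), Im (gam s)))
  by (intros s; destruct (gam s); reflexivity).
apply is_derive_Reals in H1; apply is_derive_Reals in H2.
split.
- apply (is_derive_ext (fun s => Re (F (Re (gam s), Im (gam s))))).
  { intros s; now rewrite (Eta s) at 3. }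
  evar_last.
  + apply is_derive_Reals.
    exact (derivable_pt_lim_comp_2d _ _ _ _ _ _ _ _ Hu H1 H2).
  + destruct w; simpl; field.
- apply (is_derive_ext (fun s => Im (F (Re (gam s), Im (gam s))))).
  { intros s; now rewrite (Eta s) at 3. }
  evar_last.
  + apply is_derive_Reals.
    exact (derivable_pt_lim_comp_2d _ _ _ _ _ _ _ _ Hv H1 H2).
  + destruct w; simpl; field.
Qed.

Lemma wirtinger_plus (F G : C -> C) (z p q p' q' : C) :
  wirtinger F z p q -> wirtinger G z p' q' ->
  wirtinger (fun z => (F z + G z)%C) z (p + p')%C (q + q')%C.
Proof.
intros HF HG gam t w Hz Hw.
replace (_ + _)%C with ((p * w + q * Cconj w) + (p' * w + q' * Cconj w))%C by ring.
apply cderive_plus; [now apply HF | now apply HG].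
Qed.

Lemma wirtinger_scal (c : C) (F : C -> C) (z p q : C) :
  wirtinger F z p q -> wirtinger (fun z => (c * F z)%C) z (c * p)%C (c * q)%C.
Proof.
intros HF gam t w Hz Hw.
replace (_ + _)%C with (c * (p * w + q * Cconj w))%C by ring.
apply cderive_scal; now apply HF.
Qed.

(** * A mean value inequality for curves *)

Lemma Re_mult_conj (c : C) : Re (Cconj c * c)%C = Cmod c ^ 2.
Proof. rewrite Cmod2_alt; destruct c; simpl; ring. Qed.

(* The mean value theorem for [Re (conj w * phi) - |w| * beta], where
   [w = phi b - phi a]. *)
Lemma curve_growth (phi dphi : R -> C) (beta dbeta : R -> R) (a b : R) :
  a <= b ->
  (forall t, a <= t <= b -> cderive phi t (dphi t)) ->
  (forall t, a <= t <= b -> is_derive beta t (dbeta t)) ->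
  (forall t, a <= t <= b -> Cmod (dphi t) <= dbeta t) ->
  Cmod (phi b - phi a)%C <= beta b - beta a.
Proof.
intros Hab Hphi Hbeta Hle.
set (w := (phi b - phi a)%C).
assert (Hd : forall t, a <= t <= b ->
  is_derive (fun t => Re (Cconj w * phi t)%C - Cmod w * beta t) t
    (Re (Cconj w * dphi t)%C - Cmod w * dbeta t)).
{ intros t Ht; apply (is_derive_minus (fun t => Re (Cconj w * phi t)%C)).
  - exact (proj1 (cderive_scal (Cconj w) _ _ _ (Hphi t Ht))).
  - apply (is_derive_scal beta), Hbeta, Ht. }
assert (Hm : Re (Cconj w * phi b)%C - Cmod w * beta b
  <= Re (Cconj w * phi a)%C - Cmod w * beta a).
{ destruct (MVT_gen (fun t => Re (Cconj w * phi t)%C - Cmod w * beta t) a b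
    (fun t => Re (Cconj w * dphi t)%C - Cmod w * dbeta t)) as [c [Hc E]].
  - intros x; rewrite Rmin_left, Rmax_right by lra; intros Hx; apply Hd; lra.
  - intros x; rewrite Rmin_left, Rmax_right by lra; intros Hx.
    apply derivable_continuous_pt; eexists; apply is_derive_Reals, Hd, Hx.
  - rewrite Rmin_left, Rmax_right in Hc by lra.
    assert (H1 := re_le_Cmod (Cconj w * dphi c)%C).
    rewrite Cmod_mult, Cmod_conj in H1.
    apply Rabs_le_between in H1.
    assert (H2 := Rmult_le_compat_l _ _ _ (Cmod_ge_0 w) (Hle c Hc)).
    assert (0 <= b - a) by lra.
    nra. }
assert (Hw : Re (Cconj w * phi b)%C - Re (Cconj w * phi a)%C = Cmod w ^ 2).
{ rewrite <- Re_mult_conj; unfold w; simpl; ring. }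
assert (H0 := Cmod_ge_0 w).
destruct (Rle_lt_or_eq_dec _ _ H0) as [Hp | Hz]; [nra|].
(* When [w = 0] there is nothing to divide by. The claim is then that [beta] does not decrease,
   which holds because [dbeta] dominates a modulus. *)
rewrite <- Hz.
assert (forall t, a <= t <= b -> 0 <= dbeta t)
  by (intros t Ht; generalize (Hle t Ht) (Cmod_ge_0 (dphi t)); lra).
destruct (MVT_gen beta a b dbeta) as [c [Hc E]].
- intros x; rewrite Rmin_left, Rmax_right by lra; intros Hx; apply Hbeta; lra.
- intros x; rewrite Rmin_left, Rmax_right by lra; intros Hx.
  apply derivable_continuous_pt; eexists; apply is_derive_Reals, Hbeta, Hx.
- rewrite Rmin_left, Rmax_right in Hc by lra.
  generalize (H c Hc); nra.
Qed.

(** * Continuity in the plane, in terms of the modulus *)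

Definition Ccontinuous (G : C -> C) (z : C) : Prop :=
  forall eps, 0 < eps -> exists delta, 0 < delta /\
    forall w, Cmod (w - z)%C < delta -> Cmod (G w - G z)%C < eps.

Lemma Cmod_le_abs (z : C) : Cmod z <= Rabs (Re z) + Rabs (Im z).
Proof.
apply Rsqr_incr_0_var; [|generalize (Rabs_pos (Re z)) (Rabs_pos (Im z)); lra].
generalize (Cmod2_alt z) (pow2_abs (Re z)) (pow2_abs (Im z))
  (Rabs_pos (Re z)) (Rabs_pos (Im z)); unfold Rsqr; nra.
Qed.

Lemma im_le_Cmod (z : C) : Rabs (Im z) <= Cmod z.
Proof. exact (Rle_trans _ _ _ (Rmax_r _ _) (Rmax_Cmod z)). Qed.

Lemma continuity_2d_pt_Ccontinuous (G : C -> C) (X Y : R -> R -> R) (x y : R) :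
  continuity_2d_pt X x y -> continuity_2d_pt Y x y ->
  Ccontinuous G (X x y, Y x y) ->
  continuity_2d_pt (fun u v => Re (G (X u v, Y u v))) x y.
Proof.
intros HX HY HG eps.
destruct (HG eps (cond_pos eps)) as [d [Hd H]].
assert (Hd2 : 0 < d / 2) by lra.
destruct (HX (mkposreal _ Hd2)) as [d1 H1], (HY (mkposreal _ Hd2)) as [d2 H2].
exists (mkposreal _ (Rmin_pos _ _ (cond_pos d1) (cond_pos d2))); simpl.
intros u v Hu Hv.
eapply Rle_lt_trans; [|apply (H (X u v, Y u v))].
- exact (re_le_Cmod (G (X u v, Y u v) - G (X x y, Y x y))%C).
- eapply Rle_lt_trans; [apply Cmod_le_abs|simpl].
  assert (Hu1 := Rlt_le_trans _ _ _ Hu (Rmin_l _ _)).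
  assert (Hv1 := Rlt_le_trans _ _ _ Hv (Rmin_l _ _)).
  assert (Hu2 := Rlt_le_trans _ _ _ Hu (Rmin_r _ _)).
  assert (Hv2 := Rlt_le_trans _ _ _ Hv (Rmin_r _ _)).
  generalize (H1 u v Hu1 Hv1) (H2 u v Hu2 Hv2); simpl; unfold Rminus; lra.
Qed.

Lemma continuity_2d_pt_snd (f : R -> R -> R) (x y : R) :
  continuity_2d_pt f x y -> continuous (fun v => f x v) y.
Proof.
intros H; apply filterlim_locally; intros eps.
destruct (H eps) as [d Hd]; exists d; intros v Hv.
apply Hd; [rewrite Rminus_diag, Rabs_R0; apply cond_pos | exact Hv].
Qed.

(** * Cauchy's estimate on circles *)

Definition arc (a : C) (s t : R) : C := (a + RtoC s * cis t)%C.

Lemma Cmod_arc (a : C) (s t : R) : Cmod (arc a s t - a)%C = Rabs s.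
Proof.
unfold arc; replace (_ - _)%C with (RtoC s * cis t)%C by ring.
rewrite Cmod_mult, Cmod_cis, Cmod_R; ring.
Qed.

Lemma continuity_2d_pt_arc (G : C -> C) (a : C) (s t : R) :
  Ccontinuous G (arc a s t) ->
  continuity_2d_pt (fun s t => Re (G (arc a s t))) s t.
Proof.
assert (E : forall u v, arc a u v = (Re a + u * cos v, Im a + u * sin v)).
{ intros u v; unfold arc, cis; destruct a.
  unfold Cplus, Cmult, RtoC, Re, Im; simpl; f_equal; ring. }
rewrite E; intros H.
apply (continuity_2d_pt_ext
  (fun u v => Re (G (Re a + u * cos v, Im a + u * sin v)))).
{ intros u v; now rewrite E. }
apply continuity_2d_pt_Ccontinuous; [| |exact H];
  (apply continuity_2d_pt_plus; [apply continuity_2d_pt_const|]);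
  (apply continuity_2d_pt_mult; [apply continuity_2d_pt_id1|]).
- apply (continuity_1d_2d_pt_comp cos (fun _ v => v));
    [apply continuity_cos | apply continuity_2d_pt_id2].
- apply (continuity_1d_2d_pt_comp sin (fun _ v => v));
    [apply continuity_sin | apply continuity_2d_pt_id2].
Qed.

(* [psi s] below is [Re] of the Cauchy integral for [2 pi s F'(a)].  Its
   derivative is [RInt (Re F')], and integrating the angular derivative of
   [i F / cis] over the circle gives [psi s = s * psi' s]; so [psi] is linear,
   of slope [psi' 0 = 2 pi Re (F' a)]. *)
Lemma cauchy_estimate_Re (F F' : C -> C) (a : C) (r M s : R) :
  (forall z, open_disc a r z -> cauchy_riemann F z (F' z)) ->
  (forall z, open_disc a r z -> Ccontinuous F' z) ->
  (forall z, open_disc a r z -> Cmod (F z) <= M) ->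
  0 < s < r -> s * Re (F' a) <= M.
Proof.
intros HF HC HM Hs.
assert (Harc : forall s t, Rabs s < r -> open_disc a r (arc a s t)).
{ intros; unfold open_disc; now rewrite Cmod_arc. }
(* With $z=a+s\,e^{it}$ one has $F(z)\,dz/(z-a)^2 = (i/s)F(z)e^{-it}\,dt$, and [Cconj (cis t)] is
   $e^{-it}$. Hence [A] is the real part of the Cauchy integrand for the derivative, scaled by
   [s]. *)
set (A := fun s t => Re (F (arc a s t) * Cconj (cis t))%C).
assert (HA1 : forall s t, Rabs s < r ->
  is_derive (fun s => A s t) s (Re (F' (arc a s t)))).
{ intros u t Hu.
  refine (proj1 (cderive_eq (fun s => (F (arc a s t) * Cconj (cis t))%C) u
    ((F' (arc a u t) * cis t + RtoC 0 * Cconj (cis t)) * Cconj (cis t)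
      + F (arc a u t) * RtoC 0)%C (F' (arc a u t)) _ _)).
  - apply cderive_mult; [|apply cderive_const].
    apply (HF (arc a u t) (Harc u t Hu) (fun s => arc a s t)); [reflexivity|].
    apply cderive_line.
  - transitivity (F' (arc a u t) * (cis t * Cconj (cis t)))%C; [ring|].
    rewrite cis_conj; ring. }
assert (HA2 : forall s t, Rabs s < r ->
  cderive (fun t => F (arc a s t)) t (F' (arc a s t) * (RtoC s * (Ci * cis t)))%C).
{ intros u t Hu.
  eapply cderive_eq;
    [apply (HF (arc a u t) (Harc u t Hu) (fun t => arc a u t)); [reflexivity|]|].
  - eapply cderive_plus; [apply cderive_const|].
    apply cderive_scal, cderive_cis.
  - ring. }
assert (HB : forall s t, Rabs s < r ->
  is_derive (fun t => Re (Ci * Cconj (cis t) * F (arc a s t))%C) t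
    (A s t - s * Re (F' (arc a s t)))).
{ intros u t Hu.
  evar_last.
  - exact (proj1 (cderive_mult _ _ _ _ _
      (cderive_scal Ci _ _ _ (cderive_conj _ _ _ (cderive_cis t))) (HA2 u t Hu))).
  - transitivity (Re (F (arc a u t) * Cconj (cis t)
      - RtoC u * F' (arc a u t) * (cis t * Cconj (cis t)))%C).
    + generalize (F (arc a u t)) (F' (arc a u t)) (cis t).
      intros [x1 y1] [x2 y2] [x3 y3]; simpl; ring.
    + rewrite cis_conj; unfold A.
      generalize (F (arc a u t)) (F' (arc a u t)) (cis t).
      intros [x1 y1] [x2 y2] [x3 y3]; simpl; ring. }
assert (Hc' : forall s t, Rabs s < r ->
  continuity_2d_pt (fun s t => Re (F' (arc a s t))) s t).
{ intros u t Hu; apply continuity_2d_pt_arc, HC, Harc, Hu. }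
assert (HcA : forall s t, Rabs s < r -> continuous (A s) t).
{ intros u t Hu.
  apply (ex_derive_continuous (A u)).
  eexists; exact (proj1 (cderive_mult _ _ _ _ _ (HA2 u t Hu)
    (cderive_conj _ _ _ (cderive_cis t)))). }
assert (HexA : forall s, Rabs s < r -> ex_RInt (A s) 0 (2 * PI)).
{ intros u Hu; apply (ex_RInt_continuous (V := R_CompleteNormedModule)).
  intros; now apply HcA. }
assert (HexF' : forall s, Rabs s < r ->
  ex_RInt (fun t => Re (F' (arc a s t))) 0 (2 * PI)).
{ intros u Hu; apply (ex_RInt_continuous (V := R_CompleteNormedModule)).
  intros t _; exact (continuity_2d_pt_snd _ _ _ (Hc' u t Hu)). }
set (psi := (fun s => RInt (A s) 0 (2 * PI)) : R -> R).
set (I := (fun s => RInt (fun t => Re (F' (arc a s t))) 0 (2 * PI)) : R -> R).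
assert (Hnear : forall u, Rabs u < r -> locally u (fun v => Rabs v < r)).
{ intros u Hu.
  assert (Hd : 0 < r - Rabs u) by lra.
  exists (mkposreal _ Hd); intros v Hv.
  change (Rabs (v - u) < r - Rabs u) in Hv.
  generalize (Rabs_triang_inv v u); lra. }
assert (Hpsi : forall u, Rabs u < r -> is_derive psi u (I u)).
{ intros u Hu.
  evar_last.
  - apply is_derive_RInt_param.
    + apply (filter_imp _ _ (fun v Hv t _ => ex_intro _ _ (HA1 v t Hv))), Hnear, Hu.
    + intros t _.
      apply (continuity_2d_pt_ext_loc (fun s t => Re (F' (arc a s t))));
        [|now apply Hc'].
      destruct (Hnear u Hu) as [d Hd]; exists d; intros v w Hv _.
      symmetry; apply is_derive_unique, HA1, Hd, Hv.
    + apply (filter_imp _ _ HexA), Hnear, Hu.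
  - apply RInt_ext; intros t _; apply is_derive_unique, HA1, Hu. }
assert (HpsiI : forall u, Rabs u < r -> psi u = u * I u).
{ intros u Hu.
  assert (E : is_RInt (fun t => A u t - u * Re (F' (arc a u t))) 0 (2 * PI) 0).
  { evar_last.
    - apply (is_RInt_derive (V := R_CompleteNormedModule)).
      + intros t _; exact (HB u t Hu).
      + intros t _.
        apply (continuous_minus (A u) (fun t => u * Re (F' (arc a u t)))).
        * now apply HcA.
        * apply (continuous_scal_r u (fun t => Re (F' (arc a u t)))).
          exact (continuity_2d_pt_snd _ _ _ (Hc' u t Hu)).
    - unfold arc, cis; rewrite cos_2PI, sin_2PI, cos_0, sin_0; apply Rminus_diag. }
  assert (E' : is_RInt (fun t => A u t - u * Re (F' (arc a u t))) 0 (2 * PI)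
    (psi u - u * I u)).
  { apply (is_RInt_minus (V := R_NormedModule)).
    - apply (RInt_correct (V := R_CompleteNormedModule)), HexA, Hu.
    - apply (is_RInt_scal (V := R_NormedModule)).
      apply (RInt_correct (V := R_CompleteNormedModule)), HexF', Hu. }
  apply (is_RInt_unique (V := R_CompleteNormedModule)) in E, E'.
  rewrite E in E'; lra. }
assert (Hr0 : Rabs 0 < r) by (rewrite Rabs_R0; lra).
assert (HI0 : I 0 = 2 * PI * Re (F' a)).
{ unfold I; rewrite (RInt_ext _ (fun _ => Re (F' a))).
  - rewrite RInt_const; unfold scal; simpl; unfold mult; simpl; ring.
  - intros t _; f_equal; f_equal; unfold arc; ring. }
assert (Hpos : forall u, 0 < u < r -> Rabs u < r).
{ intros; rewrite Rabs_pos_eq; lra. }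
assert (Hslope : forall u, 0 < u < r -> I u = I s).
(* Since [psi u = u * I u] and [I] is the derivative of [psi], the quotient [psi u / u] has
   derivative zero away from 0. *)
{ assert (Hd : forall u, 0 < u < r -> is_derive (fun u => psi u / u) u 0).
  { intros u Hu.
    evar_last.
    - apply is_derive_div;
        [apply Hpsi, Hpos, Hu | apply (is_derive_id (K := R_AbsRing)) | lra].
    - rewrite (HpsiI u (Hpos u Hu)); unfold one; simpl; field; lra. }
  intros u Hu.
  assert (E : forall v, 0 < v < r -> psi v / v = I v).
  { intros v Hv; rewrite (HpsiI v (Hpos v Hv)); field; lra. }
  rewrite <- !E by assumption.
  destruct (MVT_gen (fun u => psi u / u) s u (fun _ => 0)) as [c [_ Ec]].
  - intros x Hx; apply Hd; revert Hx; unfold Rmin, Rmax; destruct Rle_dec; lra.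
  - intros x Hx; apply derivable_continuous_pt; eexists.
    apply is_derive_Reals, Hd; revert Hx; unfold Rmin, Rmax; destruct Rle_dec; lra.
  - lra. }
assert (HIs : I s = I 0).
(* For small positive [u] the difference quotient of [psi] at 0 is [I u], which is the constant
   [I s]. It tends to the derivative [I 0], so the two agree. *)
{ destruct (Req_dec (I s) (I 0)) as [|Hne]; [assumption|exfalso].
  assert (Heps : 0 < Rabs (I s - I 0)) by (apply Rabs_pos_lt; lra).
  destruct (proj1 (is_derive_Reals _ _ _) (Hpsi 0 Hr0) _ Heps) as [d Hd].
  set (u := Rmin (d / 2) s).
  assert (Hu : 0 < u <= s).
  { split; [apply Rmin_pos; [generalize (cond_pos d)|]; lra | apply Rmin_r]. }
  assert (Hud : Rabs u < d).
  { rewrite Rabs_pos_eq by lra.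
    generalize (Rmin_l (d / 2) s) (cond_pos d); fold u; lra. }
  specialize (Hd u ltac:(lra) Hud).
  rewrite Rplus_0_l, (HpsiI 0 Hr0), (HpsiI u ltac:(apply Hpos; lra)),
    (Hslope u ltac:(lra)) in Hd.
  replace ((u * I s - 0 * I 0) / u) with (I s) in Hd by (field; lra).
  lra. }
assert (Hbound : psi s <= 2 * PI * M).
{ replace (2 * PI * M) with (RInt (fun _ => M) 0 (2 * PI))
    by (rewrite RInt_const; unfold scal; simpl; unfold mult; simpl; ring).
  apply RInt_le; [generalize PI_RGT_0; lra | apply HexA, Hpos, Hs
    | apply ex_RInt_const | intros t _].
  eapply Rle_trans; [apply Rle_abs|].
  eapply Rle_trans; [apply re_le_Cmod|].
  rewrite Cmod_mult, Cmod_conj, Cmod_cis, Rmult_1_r.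
  apply HM, Harc, Hpos, Hs. }
rewrite (HpsiI s (Hpos s Hs)), HIs, HI0 in Hbound.
generalize PI_RGT_0; intros; nra.
Qed.

(** These rotations turn a bound on real parts into a bound on moduli, and a sum of moduli into the
    modulus of one sum. *)
Lemma Cmod_unimodular (z : C) : exists c, Cmod c = 1 /\ (c * z)%C = RtoC (Cmod z).
Proof.
destruct (Ceq_dec z (RtoC 0)) as [-> | Hz].
- exists (RtoC 1); rewrite Cmod_1, Cmod_0; split; [reflexivity | ring].
- assert (H := proj1 (Cmod_gt_0 z) Hz).
  assert (H1 : RtoC (Cmod z) <> RtoC 0) by (intros E; apply RtoC_inj in E; lra).
  exists (Cconj z / RtoC (Cmod z))%C; split.
  + rewrite Cmod_div by assumption.
    rewrite Cmod_conj, Cmod_R, Rabs_pos_eq by lra; field; lra.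
  + transitivity ((z * Cconj z) / RtoC (Cmod z))%C; [field; assumption|].
    rewrite <- Cmod2_conj, RtoC_pow; field; assumption.
Qed.

Lemma Ccontinuous_scal (c : C) (G : C -> C) (z : C) :
  Ccontinuous G z -> Ccontinuous (fun z => (c * G z)%C) z.
Proof.
intros H eps Heps.
assert (Hc := Cmod_ge_0 c).
destruct (H (eps / (Cmod c + 1))) as [d [Hd Hw]].
{ apply Rdiv_lt_0_compat; lra. }
exists d; split; [assumption | intros w Hwz].
replace (c * G w - c * G z)%C with (c * (G w - G z))%C by ring.
rewrite Cmod_mult.
specialize (Hw w Hwz).
assert (H0 := Cmod_ge_0 (G w - G z)%C).
assert (Cmod (G w - G z)%C * (Cmod c + 1) < eps).
{ apply (Rmult_lt_reg_r (/ (Cmod c + 1))); [apply Rinv_0_lt_compat; lra|].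
  rewrite Rmult_assoc, Rinv_r, Rmult_1_r by lra; exact Hw. }
nra.
Qed.

Lemma Ccontinuous_plus (G H : C -> C) (z : C) :
  Ccontinuous G z -> Ccontinuous H z -> Ccontinuous (fun z => (G z + H z)%C) z.
Proof.
intros HG HH eps Heps.
destruct (HG (eps / 2)) as [d1 [Hd1 H1]]; [lra|].
destruct (HH (eps / 2)) as [d2 [Hd2 H2]]; [lra|].
exists (Rmin d1 d2); split; [now apply Rmin_pos | intros w Hw].
replace (_ - _)%C with ((G w - G z) + (H w - H z))%C by ring.
eapply Rle_lt_trans; [apply Cmod_triangle|].
generalize (H1 w (Rlt_le_trans _ _ _ Hw (Rmin_l _ _)))
  (H2 w (Rlt_le_trans _ _ _ Hw (Rmin_r _ _))); lra.
Qed.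

(** After a rotation of [F] the derivative at [a] is real and nonnegative, so the estimate for real
    parts bounds its modulus on every smaller circle. Letting [s] approach [r] gives the bound. *)
Lemma cauchy_estimate (F F' : C -> C) (a : C) (r M : R) :
  0 < r ->
  (forall z, open_disc a r z -> cauchy_riemann F z (F' z)) ->
  (forall z, open_disc a r z -> Ccontinuous F' z) ->
  (forall z, open_disc a r z -> Cmod (F z) <= M) ->
  Cmod (F' a) <= M / r.
Proof.
intros Hr HF HC HM.
destruct (Cmod_unimodular (F' a)) as [c [Hc E]].
assert (H : forall s, 0 < s < r -> s * Cmod (F' a) <= M).
{ intros s Hs.
  replace (Cmod (F' a)) with (Re (c * F' a)%C) by now rewrite E.
  apply (cauchy_estimate_Re (fun z => (c * F z)%C) (fun z => (c * F' z)%C) a r M s);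
    [| | |exact Hs]; intros z Hz.
  - unfold cauchy_riemann.
    rewrite <- (Cmult_0_r c).
    now apply wirtinger_scal, HF.
  - now apply Ccontinuous_scal, HC.
  - rewrite Cmod_mult, Hc, Rmult_1_l; now apply HM. }
assert (H0 := Cmod_ge_0 (F' a)).
apply (Rmult_le_reg_r r); [assumption|].
unfold Rdiv; rewrite Rmult_assoc, Rinv_l, Rmult_1_r by lra.
apply Rnot_lt_le; intros Hlt.
assert (HM0 : 0 <= M) by (generalize (H (r / 2) ltac:(lra)); nra).
assert (Hp : 0 < Cmod (F' a)) by nra.
(* If the bound failed, [M / Cmod (F' a)] would be less than [r]. At the midpoint [s] of the two,
   [s * Cmod (F' a)] exceeds [M], a contradiction. *)
set (s := (r + M / Cmod (F' a)) / 2).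
assert (Hq : M / Cmod (F' a) < r).
{ apply (Rmult_lt_reg_r (Cmod (F' a))); [assumption|].
  unfold Rdiv; rewrite Rmult_assoc, Rinv_l; lra. }
assert (Hq0 : 0 <= M / Cmod (F' a)).
{ apply Rmult_le_pos; [assumption | left; now apply Rinv_0_lt_compat]. }
assert (Hs := H s ltac:(unfold s; lra)).
assert (M / Cmod (F' a) * Cmod (F' a) = M) by (field; lra).
unfold s in Hs; nra.
Qed.

(** Around each point of the segment from 0 to [z] the disc of radius [1 - Cmod z] stays in the unit
    disc, so Cauchy's estimate bounds the derivative there by [M / (1 - Cmod z)]. The segment has
    length [Cmod z]. *)
Lemma bounded_analytic_growth (F F' : C -> C) (M : R) :
  (forall z, open_disc (RtoC 0) 1 z -> cauchy_riemann F z (F' z)) ->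
  (forall z, open_disc (RtoC 0) 1 z -> Ccontinuous F' z) ->
  (forall z, open_disc (RtoC 0) 1 z -> Cmod (F z) <= M) ->
  forall z, open_disc (RtoC 0) 1 z ->
  Cmod (F z - F (RtoC 0))%C <= M * Cmod z / (1 - Cmod z).
Proof.
intros HF HC HM z Hz.
assert (Hin : forall w, Cmod w < 1 -> open_disc (RtoC 0) 1 w).
{ intros w Hw; unfold open_disc; now replace (w - RtoC 0)%C with w by ring. }
assert (Hz1 : Cmod z < 1).
{ unfold open_disc in Hz; now replace (z - RtoC 0)%C with z in Hz by ring. }
assert (Hz0 := Cmod_ge_0 z).
assert (HM0 : 0 <= M) by (eapply Rle_trans; [apply Cmod_ge_0 | apply (HM z Hz)]).
assert (Ht : forall t, 0 <= t <= 1 -> Cmod (RtoC 0 + RtoC t * z)%C <= Cmod z).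
{ intros t Ht; replace (_ + _)%C with (RtoC t * z)%C by ring.
  rewrite Cmod_mult, Cmod_R, Rabs_pos_eq by lra; nra. }
assert (E : (F z - F (RtoC 0))%C
  = (F (RtoC 0 + RtoC 1 * z) - F (RtoC 0 + RtoC 0 * z))%C).
{ f_equal; [|f_equal]; f_equal; ring. }
rewrite E.
set (k := M * Cmod z / (1 - Cmod z)).
replace k with (k * 1 - k * 0) by ring.
apply (curve_growth (fun t => F (RtoC 0 + RtoC t * z)%C)
  (fun t => F' (RtoC 0 + RtoC t * z) * z)%C (fun t => k * t) (fun _ => k) 0 1); [lra| | |].
- intros t Ht'.
  eapply cderive_eq; [apply (HF (RtoC 0 + RtoC t * z)%C) with (w := z)|].
  + apply Hin; generalize (Ht t Ht'); lra.
  + reflexivity.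
  + apply cderive_line.
  + ring.
- intros t _; auto_derive; auto; ring.
- intros t Ht'; specialize (Ht t Ht'); rewrite Cmod_mult.
  assert (Hb : Cmod (F' (RtoC 0 + RtoC t * z)%C) <= M / (1 - Cmod z)).
  { apply (cauchy_estimate F F'); [lra | | |];
    intros w Hw; [apply HF | apply HC | apply HM];
    apply Hin; unfold open_disc in Hw;
    replace w with ((w - (RtoC 0 + RtoC t * z)) + (RtoC 0 + RtoC t * z))%C by ring;
    (eapply Rle_lt_trans; [apply Cmod_triangle | lra]). }
  unfold k; replace (M * Cmod z / (1 - Cmod z)) with (M / (1 - Cmod z) * Cmod z)
    by (field; lra).
  now apply Rmult_le_compat_r.
Qed.

(** * Holomorphy of the Wirtinger derivatives of a harmonic map *)

Lemma wirtinger_conj (F : C -> C) (z p q : C) :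
  wirtinger F z p q -> wirtinger (fun z => Cconj (F z)) z (Cconj q) (Cconj p).
Proof.
intros HF gam t w Hz Hw.
eapply cderive_eq; [apply cderive_conj, (HF gam t w Hz Hw)|].
rewrite Cplus_conj, !Cmult_conj, Cconj_conj; ring.
Qed.

Lemma wirtinger_eq (F G : C -> C) (z p q p' q' : C) :
  wirtinger F z p q -> (forall z, F z = G z) -> p = p' -> q = q' ->
  wirtinger G z p' q'.
Proof.
intros HF E <- <- gam t w Hz Hw.
destruct (HF gam t w Hz Hw) as [H1 H2].
split; [eapply is_derive_ext; [|exact H1] | eapply is_derive_ext; [|exact H2]];
  intros s; simpl; now rewrite E.
Qed.

Lemma Ccontinuous_conj (G : C -> C) (z : C) :
  Ccontinuous G z -> Ccontinuous (fun z => Cconj (G z)) z.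
Proof.
intros H eps Heps; destruct (H eps Heps) as [d [Hd Hw]].
exists d; split; [assumption | intros w Hwz].
rewrite <- Cminus_conj, Cmod_conj; now apply Hw.
Qed.

Lemma Ccontinuous_intro (G : C -> C) (x y : R) :
  continuity_2d_pt (fun x y => Re (G (x, y))) x y ->
  continuity_2d_pt (fun x y => Im (G (x, y))) x y ->
  Ccontinuous G (x, y).
Proof.
intros HR HI eps Heps.
assert (He : 0 < eps / 2) by lra.
destruct (HR (mkposreal _ He)) as [d1 H1], (HI (mkposreal _ He)) as [d2 H2].
simpl in H1, H2.
exists (Rmin d1 d2); split; [apply Rmin_pos; apply cond_pos|].
intros [u v] Hw.
assert (Hu : Rabs (u - x) < Rmin d1 d2)
  by exact (Rle_lt_trans _ _ _ (re_le_Cmod ((u, v) - (x, y))%C) Hw).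
assert (Hv : Rabs (v - y) < Rmin d1 d2)
  by exact (Rle_lt_trans _ _ _ (im_le_Cmod ((u, v) - (x, y))%C) Hw).
assert (A1 := H1 u v (Rlt_le_trans _ _ _ Hu (Rmin_l _ _)) (Rlt_le_trans _ _ _ Hv (Rmin_l _ _))).
assert (A2 := H2 u v (Rlt_le_trans _ _ _ Hu (Rmin_r _ _)) (Rlt_le_trans _ _ _ Hv (Rmin_r _ _))).
eapply Rle_lt_trans; [apply Cmod_le_abs|].
change (Rabs (Re (G (u, v)) - Re (G (x, y))) + Rabs (Im (G (u, v)) - Im (G (x, y))) < eps).
lra.
Qed.

Lemma open_disc_locally_2d (a : C) (r x y : R) :
  open_disc a r (x, y) -> locally_2d (fun u v => open_disc a r (u, v)) x y.
Proof.
unfold open_disc; intros H.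
assert (Hd : 0 < (r - Cmod ((x, y) - a)%C) / 2) by lra.
exists (mkposreal _ Hd); simpl; intros u v Hu Hv.
replace ((u, v) - a)%C with (((u, v) - (x, y)) + ((x, y) - a))%C by ring.
eapply Rle_lt_trans; [apply Cmod_triangle|].
assert (A := Cmod_le_abs ((u, v) - (x, y))%C).
change (Re ((u, v) - (x, y))%C) with (u - x) in A.
change (Im ((u, v) - (x, y))%C) with (v - y) in A.
lra.
Qed.

Definition C1_on (S : C -> Prop) (G : C -> C) : Prop :=
  forall x y, S (x, y) ->
    ex_diff_n (fun x y => Re (G (x, y))) 1 x y /\
    ex_diff_n (fun x y => Im (G (x, y))) 1 x y.

(** Total differentiability comes from the [x]-partial, which exists nearby and is continuous at the
    point, together with the [y]-partial at the point. *)
Lemma C1_differentiable (f : R -> R -> R) (x y : R) :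
  locally_2d (fun u v => ex_diff_n f 1 u v) x y ->
  differentiable_pt_lim f x y (Derive (fun t => f t y) x) (Derive (fun t => f x t) y).
Proof.
intros H.
destruct (locally_2d_singleton _ _ _ H) as [_ [_ [H1 [[H2 _] _]]]].
apply filterdiff_differentiable_pt_lim.
apply (is_derive_filterdiff f x y (fun u v => Derive (fun t => f t v) u)).
- apply locally_2d_locally in H; revert H; apply filter_imp.
  intros [u v] [_ [Hu _]]; now apply Derive_correct.
- now apply Derive_correct.
- exact (proj1 (continuity_2d_pt_filterlim _ _ _) H2).
Qed.

Lemma d_zE (f : C -> C) (z : C) :
  d_z f z = ((Re (d_x f z) + Im (d_y f z)) / 2, (Im (d_x f z) - Re (d_y f z)) / 2).
Proof.
unfold d_z; destruct (d_x f z), (d_y f z).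
apply injective_projections; simpl; field.
Qed.

Lemma d_zbarE (f : C -> C) (z : C) :
  d_zbar f z = ((Re (d_x f z) - Im (d_y f z)) / 2, (Im (d_x f z) + Re (d_y f z)) / 2).
Proof.
unfold d_zbar; destruct (d_x f z), (d_y f z).
apply injective_projections; simpl; field.
Qed.

Lemma C1_wirtinger (a : C) (r : R) (G : C -> C) (z : C) :
  C1_on (open_disc a r) G -> open_disc a r z ->
  wirtinger G z (d_z G z) (d_zbar G z).
Proof.
intros HG Hz; destruct z as [x y].
assert (L := open_disc_locally_2d a r x y Hz).
rewrite d_zE, d_zbarE.
apply wirtinger_intro; apply C1_differentiable;
  refine (locally_2d_impl _ _ _ _ (locally_2d_forall _ _ _ _) L);
  intros u v Huv; now apply HG.
Qed.

Lemma C1_Ccontinuous_d (S : C -> Prop) (G : C -> C) (z : C) :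
  C1_on S G -> S z -> Ccontinuous (d_x G) z /\ Ccontinuous (d_y G) z.
Proof.
intros HG Hz; destruct z as [x y].
destruct (HG x y Hz) as [[_ [_ [_ [[A1 _] [A2 _]]]]] [_ [_ [_ [[B1 _] [B2 _]]]]]].
split; apply Ccontinuous_intro; assumption.
Qed.

Lemma C1_Ccontinuous_d_z (S : C -> Prop) (G : C -> C) (z : C) :
  C1_on S G -> S z -> Ccontinuous (d_z G) z /\ Ccontinuous (d_zbar G) z.
Proof.
intros HG Hz; destruct (C1_Ccontinuous_d S G z HG Hz) as [Hx Hy].
assert (H : forall c, Ccontinuous (fun z => (/ 2 * (d_x G z + c * d_y G z))%C) z).
{ intros c; apply Ccontinuous_scal, Ccontinuous_plus; [|apply Ccontinuous_scal];
  assumption. }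
assert (E1 : forall z, d_z G z = (/ 2 * (d_x G z + (- Ci) * d_y G z))%C).
{ intros w; unfold d_z, Cdiv; ring. }
assert (E2 : forall z, d_zbar G z = (/ 2 * (d_x G z + Ci * d_y G z))%C).
{ intros w; unfold d_zbar, Cdiv; ring. }
split; intros eps Heps.
- destruct (H (- Ci)%C eps Heps) as [d [Hd Hw]]; exists d; split; [assumption|].
  intros w; rewrite !E1; apply Hw.
- destruct (H Ci eps Heps) as [d [Hd Hw]]; exists d; split; [assumption|].
  intros w; rewrite !E2; apply Hw.
Qed.

Lemma harmonic_C1 (S : C -> Prop) (f : C -> C) :
  harmonic_on S f -> C1_on S f /\ C1_on S (d_x f) /\ C1_on S (d_y f).
Proof.
intros [Hu Hv].
assert (H21 : forall g x y, ex_diff_n g 2 x y -> ex_diff_n g 1 x y).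
{ intros g x y [H0 [H1 [H2 [[H3 _] [H4 _]]]]]; repeat split; assumption. }
split; [|split]; intros x y Hxy;
  destruct (Hu x y Hxy) as [Hu2 _], (Hv x y Hxy) as [Hv2 _].
- split; now apply H21.
- split; [exact (proj1 (proj2 (proj2 (proj2 Hu2))))
    | exact (proj1 (proj2 (proj2 (proj2 Hv2))))].
- split; [exact (proj2 (proj2 (proj2 (proj2 Hu2))))
    | exact (proj2 (proj2 (proj2 (proj2 Hv2))))].
Qed.

Lemma real_harmonic_Schwarz (a : C) (r : R) (u : R -> R -> R) (x y : R) :
  real_harmonic_on (open_disc a r) u -> open_disc a r (x, y) ->
  Derive (fun s => Derive (fun t => u s t) y) x
    = Derive (fun s => Derive (fun t => u t s) x) y.
Proof.
intros Hu Hxy.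
(* [A] and [B] are the continuity of the two mixed second partials, read off from the order-1 data
   of the [x]-partial and of the [y]-partial. *)
destruct (proj1 (Hu x y Hxy)) as [_ [_ [_ [[_ [_ [_ [_ [A _]]]]] [_ [_ [_ [[B _] _]]]]]]]].
apply Schwarz; [|exact B | exact A].
refine (locally_2d_impl _ _ _ _ (locally_2d_forall _ _ _ _)
  (open_disc_locally_2d a r x y Hxy)).
intros s t Hst.
destruct (proj1 (Hu s t Hst)) as [_ [H1 [H2 [[_ [_ [H3 _]]] [_ [H4 _]]]]]].
repeat split; assumption.
Qed.

(** Once mixed partials commute, both $(f_z)_{\bar z}$ and $(f_{\bar z})_z$ are a quarter of the
    Laplacian of [f], hence zero. Conjugating [d_zbar f] turns the second identity into a
    Cauchy-Riemann equation. *)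
Lemma harmonic_wirtinger (a : C) (r : R) (f : C -> C) :
  harmonic_on (open_disc a r) f ->
  exists P Q : C -> C, forall z, open_disc a r z ->
    cauchy_riemann (d_z f) z (P z) /\ Ccontinuous P z /\
    cauchy_riemann (fun z => Cconj (d_zbar f z)) z (Q z) /\ Ccontinuous Q z.
Proof.
intros Hf; destruct (harmonic_C1 _ _ Hf) as [_ [Hx Hy]].
assert (Hmix : forall z, open_disc a r z -> d_x (d_y f) z = d_y (d_x f) z).
{ intros [x y] Hz; apply injective_projections.
  - exact (real_harmonic_Schwarz a r _ x y (proj1 Hf) Hz).
  - exact (real_harmonic_Schwarz a r _ x y (proj2 Hf) Hz). }
assert (Hlap : forall z, open_disc a r z -> (d_x (d_x f) z = - d_y (d_y f) z)%C).
{ intros [x y] Hz; apply injective_projections.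
  - generalize (proj2 (proj1 Hf x y Hz)); intros H; apply Rplus_opp_r_uniq.
    rewrite Rplus_comm; exact H.
  - generalize (proj2 (proj2 Hf x y Hz)); intros H; apply Rplus_opp_r_uniq.
    rewrite Rplus_comm; exact H. }
(* The witnesses are $f_{zz}$ and $\overline{f_{\bar z\bar z}}$, expanded through [d_x f] and
   [d_y f] so that their continuity follows from the $C^1$ regularity of these two maps. *)
exists (fun z => (/ 2 * (d_z (d_x f) z + (- Ci) * d_z (d_y f) z))%C),
  (fun z => Cconj (/ 2 * (d_zbar (d_x f) z + Ci * d_zbar (d_y f) z))%C).
intros z Hz; split; [|split; [|split]].
- eapply wirtinger_eq.
  + apply (wirtinger_scal (/ 2)%C), wirtinger_plus.
    * exact (C1_wirtinger a r _ z Hx Hz).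
    * apply (wirtinger_scal (- Ci)%C), (C1_wirtinger a r _ z Hy Hz).
  + intros w; unfold d_z, Cdiv; ring.
  + reflexivity.
  + unfold d_zbar; rewrite Hmix, Hlap by assumption.
    generalize (d_y (d_y f) z) (d_y (d_x f) z); intros [] [].
    apply injective_projections; simpl; field.
- apply Ccontinuous_scal, Ccontinuous_plus; [|apply Ccontinuous_scal];
    eapply C1_Ccontinuous_d_z; eassumption.
- eapply wirtinger_eq.
  + apply wirtinger_conj, (wirtinger_scal (/ 2)%C), wirtinger_plus.
    * exact (C1_wirtinger a r _ z Hx Hz).
    * apply (wirtinger_scal Ci), (C1_wirtinger a r _ z Hy Hz).
  + intros w; apply (f_equal Cconj); unfold d_zbar, Cdiv; ring.
  + reflexivity.
  + unfold d_z; rewrite Hmix, Hlap by assumption.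
    generalize (d_y (d_y f) z) (d_y (d_x f) z); intros [] [].
    apply injective_projections; simpl; field.
- apply Ccontinuous_conj, Ccontinuous_scal, Ccontinuous_plus;
    [|apply Ccontinuous_scal]; eapply C1_Ccontinuous_d_z; eassumption.
Qed.

(** * Deviation of a harmonic map from its differential at 0 *)

Lemma open_disc_0_intro (r : R) (z : C) : Cmod z < r -> open_disc (RtoC 0) r z.
Proof. unfold open_disc; now replace (z - RtoC 0)%C with z by ring. Qed.

Lemma open_disc_0_elim (r : R) (z : C) : open_disc (RtoC 0) r z -> Cmod z < r.
Proof. unfold open_disc; now replace (z - RtoC 0)%C with z by ring. Qed.

Lemma Cmod_minus_sym (z w : C) : Cmod (z - w)%C = Cmod (w - z)%C.
Proof. rewrite <- Cmod_opp; f_equal; ring. Qed.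

Lemma Cmod_minus_le (z w : C) : Cmod z - Cmod w <= Cmod (z - w)%C.
Proof.
generalize (Cmod_triangle (z - w) w); replace (z - w + w)%C with z by ring; lra.
Qed.

Lemma Cmod_minus_0 (z w : C) : Cmod (z - w)%C = 0 -> z = w.
Proof.
intros H; apply Cmod_eq_0 in H.
replace z with ((z - w) + w)%C by ring; rewrite H; ring.
Qed.

(** The rotations [c] and [d] are chosen for the given [z] and then kept fixed, so that one
    holomorphic function has the whole left-hand side as the modulus of its increment. Bounding each
    increment separately by [M] would double the constant. *)
Lemma wirtinger_growth (f : C -> C) (M : R) :
  harmonic_on (open_disc (RtoC 0) 1) f ->
  (forall z, open_disc (RtoC 0) 1 z -> Lambda_ f z <= M) ->
  forall z, open_disc (RtoC 0) 1 z ->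
  Cmod (d_z f z - d_z f (RtoC 0))%C + Cmod (d_zbar f z - d_zbar f (RtoC 0))%C
    <= M * Cmod z / (1 - Cmod z).
Proof.
intros Hf HM z Hz.
destruct (harmonic_wirtinger _ _ _ Hf) as [P [Q H]].
set (p := d_z f); set (q := fun z => Cconj (d_zbar f z)).
destruct (Cmod_unimodular (p z - p (RtoC 0))%C) as [c [Hc Ec]].
destruct (Cmod_unimodular (q z - q (RtoC 0))%C) as [d [Hd Ed]].
assert (E : Cmod ((c * p z + d * q z) - (c * p (RtoC 0) + d * q (RtoC 0)))%C
  = Cmod (d_z f z - d_z f (RtoC 0))%C + Cmod (d_zbar f z - d_zbar f (RtoC 0))%C).
{ transitivity (Cmod (c * (p z - p (RtoC 0)) + d * (q z - q (RtoC 0)))%C).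
  - f_equal; ring.
  - rewrite Ec, Ed, <- RtoC_plus, Cmod_R.
    unfold q; rewrite <- Cminus_conj, Cmod_conj.
    apply Rabs_pos_eq, Rplus_le_le_0_compat; apply Cmod_ge_0. }
eapply Rle_trans; [right; symmetry; exact E|].
apply (bounded_analytic_growth (fun z => (c * p z + d * q z)%C)
  (fun z => (c * P z + d * Q z)%C)); [| | |exact Hz]; intros w Hw;
  destruct (H w Hw) as [H1 [H2 [H3 H4]]].
- eapply wirtinger_eq; [exact (wirtinger_plus _ _ _ _ _ _ _
    (wirtinger_scal c _ _ _ _ H1) (wirtinger_scal d _ _ _ _ H3))| | |];
    intros; try ring; reflexivity.
- now apply Ccontinuous_plus; apply Ccontinuous_scal.
- eapply Rle_trans; [apply Cmod_triangle|].
  rewrite !Cmod_mult, Hc, Hd; unfold q; rewrite Cmod_conj.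
  generalize (HM w Hw); unfold Lambda_, p; lra.
Qed.

Definition linear_part (f : C -> C) (z : C) : C :=
  (d_z f (RtoC 0) * z + d_zbar f (RtoC 0) * Cconj z)%C.

Definition deviation (f : C -> C) (z : C) : C := (f z - linear_part f z)%C.

Definition d_deviation (f : C -> C) (z w : C) : C :=
  ((d_z f z - d_z f (RtoC 0)) * w + (d_zbar f z - d_zbar f (RtoC 0)) * Cconj w)%C.

Lemma cderive_deviation (f : C -> C) (a w : C) (t : R) :
  harmonic_on (open_disc (RtoC 0) 1) f -> Cmod (a + RtoC t * w)%C < 1 ->
  cderive (fun s => deviation f (a + RtoC s * w)%C) t (d_deviation f (a + RtoC t * w)%C w).
Proof.
intros Hf Hin.
assert (Hl : forall s, cderive (fun s => a + RtoC s * w)%C s w)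
  by (intros; apply cderive_line).
eapply cderive_eq.
- apply cderive_minus.
  + apply (C1_wirtinger (RtoC 0) 1 f (a + RtoC t * w)%C (proj1 (harmonic_C1 _ _ Hf))
      (open_disc_0_intro _ _ Hin) (fun s => a + RtoC s * w)%C t w eq_refl (Hl t)).
  + apply cderive_plus; apply cderive_scal; [|apply cderive_conj]; apply Hl.
- unfold d_deviation; ring.
Qed.

Lemma d_deviation_bound (f : C -> C) (M : R) (z w : C) :
  harmonic_on (open_disc (RtoC 0) 1) f ->
  (forall z, open_disc (RtoC 0) 1 z -> Lambda_ f z <= M) ->
  Cmod z < 1 ->
  Cmod (d_deviation f z w) <= M * Cmod z / (1 - Cmod z) * Cmod w.
Proof.
intros Hf HM Hz; eapply Rle_trans; [apply Cmod_triangle|].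
rewrite !Cmod_mult, Cmod_conj, <- Rmult_plus_distr_r.
apply Rmult_le_compat_r; [apply Cmod_ge_0|].
apply (wirtinger_growth f M Hf HM), open_disc_0_intro, Hz.
Qed.

(** The segment from [w] to [z] stays in the closed disc of radius [r], and the bound $Mx/(1-x)$ on
    the differential of the deviation increases with $x$. *)
Lemma deviation_lipschitz (f : C -> C) (M r : R) (z w : C) :
  harmonic_on (open_disc (RtoC 0) 1) f ->
  (forall z, open_disc (RtoC 0) 1 z -> Lambda_ f z <= M) ->
  0 <= M -> r < 1 -> Cmod z <= r -> Cmod w <= r ->
  Cmod (deviation f z - deviation f w)%C <= M * r / (1 - r) * Cmod (z - w)%C.
Proof.
intros Hf HM HM0 Hr Hz Hw.
assert (Hin : forall t, 0 <= t <= 1 -> Cmod (w + RtoC t * (z - w))%C <= r).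
{ intros t Ht.
  replace (w + RtoC t * (z - w))%C with (RtoC (1 - t) * w + RtoC t * z)%C
    by (rewrite RtoC_minus; ring).
  eapply Rle_trans; [apply Cmod_triangle|].
  rewrite !Cmod_mult, !Cmod_R, !Rabs_pos_eq by lra; nra. }
set (k := M * r / (1 - r) * Cmod (z - w)%C).
assert (G := curve_growth (fun t => deviation f (w + RtoC t * (z - w))%C)
  (fun t => d_deviation f (w + RtoC t * (z - w)) (z - w)%C) (fun t => k * t) (fun _ => k) 0 1).
cbv beta in G.
replace (w + RtoC 1 * (z - w))%C with z in G by ring.
replace (w + RtoC 0 * (z - w))%C with w in G by ring.
replace k with (k * 1 - k * 0) by ring.
apply G; [lra| | |].
- intros t Ht; apply cderive_deviation; [exact Hf | generalize (Hin t Ht); lra].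
- intros t _; auto_derive; auto; ring.
- intros t Ht; specialize (Hin t Ht).
  eapply Rle_trans; [apply (d_deviation_bound f M); [assumption | assumption | lra]|].
  apply Rmult_le_compat_r; [apply Cmod_ge_0|].
  set (x := Cmod (w + RtoC t * (z - w))%C) in *.
  assert (Hx : 0 <= x) by apply Cmod_ge_0.
  unfold Rdiv; rewrite !Rmult_assoc.
  apply Rmult_le_compat_l; [exact HM0|].
  apply Rmult_le_compat; [lra | left; apply Rinv_0_lt_compat; lra | lra |].
  apply Rinv_le_contravar; lra.
Qed.

(** The bound $Mx/(1-x)$ is integrated along the ray from 0 to [z]. This is sharper than the
    Lipschitz estimate with the constant at the endpoint, and it is the origin of the logarithm in
    the final radius. *)
Lemma deviation_bound (f : C -> C) (M : R) (z : C) :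
  harmonic_on (open_disc (RtoC 0) 1) f ->
  (forall z, open_disc (RtoC 0) 1 z -> Lambda_ f z <= M) ->
  f (RtoC 0) = RtoC 0 -> Cmod z < 1 ->
  Cmod (deviation f z) <= M * (- Cmod z - ln (1 - Cmod z)).
Proof.
intros Hf HM H0 Hz.
assert (Hr := Cmod_ge_0 z).
set (r := Cmod z) in *.
assert (Hin : forall t, 0 <= t <= 1 -> Cmod (RtoC 0 + RtoC t * z)%C = t * r).
{ intros t Ht; replace (RtoC 0 + RtoC t * z)%C with (RtoC t * z)%C by ring.
  rewrite Cmod_mult, Cmod_R, Rabs_pos_eq by lra; reflexivity. }
assert (G := curve_growth (fun t => deviation f (RtoC 0 + RtoC t * z)%C)
  (fun t => d_deviation f (RtoC 0 + RtoC t * z) z)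
  (fun t => M * (- (t * r) - ln (1 - t * r)))
  (fun t => M * (t * r) / (1 - t * r) * r) 0 1).
cbv beta in G.
replace (RtoC 0 + RtoC 1 * z)%C with z in G by ring.
replace (RtoC 0 + RtoC 0 * z)%C with (RtoC 0) in G by ring.
rewrite !Rmult_0_l, !Rmult_1_l, Rminus_0_r, ln_1 in G.
replace (deviation f z - deviation f (RtoC 0))%C with (deviation f z) in G.
2:{ unfold deviation, linear_part; rewrite H0.
    replace (Cconj (RtoC 0)) with (RtoC 0)
      by (unfold Cconj, RtoC; simpl; now rewrite Ropp_0).
    ring. }
replace (M * (- r - ln (1 - r)))
  with (M * (- r - ln (1 - r)) - M * (- 0 - 0)) by ring.
apply G; [lra| | |]; intros t Ht; assert (t * r < 1) by nra.
- apply cderive_deviation; [exact Hf | rewrite Hin; assumption].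
- auto_derive; [lra | field; lra].
- rewrite <- (Hin t Ht); apply d_deviation_bound; [assumption | assumption | now rewrite Hin].
Qed.

(** * Fixed points, connectedness, and perturbations of expanding maps *)

(** The iterates of [G] from 0 have increments dominated by a geometric series, so they converge,
    and the Lipschitz bound makes the limit a fixed point. *)
Lemma banach_disc (G : C -> C) (r k : R) :
  0 <= r -> 0 <= k < 1 ->
  (forall z, Cmod z <= r -> Cmod (G z) <= r) ->
  (forall z w, Cmod z <= r -> Cmod w <= r ->
    Cmod (G z - G w)%C <= k * Cmod (z - w)%C) ->
  exists z, Cmod z <= r /\ G z = z.
Proof.
intros Hr Hk Hmap Hlip.
set (u := fix u n := match n with O => RtoC 0 | S n => G (u n) end).
assert (Hu : forall n, Cmod (u n) <= r).
{ induction n; simpl; [rewrite Cmod_0; assumption | now apply Hmap]. }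
set (D := Cmod (u 1%nat - u 0%nat)%C).
assert (Hstep : forall n, Cmod (u (S n) - u n)%C <= D * k ^ n).
{ induction n; [simpl; unfold D; simpl; lra|].
  eapply Rle_trans; [apply (Hlip (u (S n)) (u n)); apply Hu|].
  simpl; generalize (Rmult_le_compat_l k _ _ (proj1 Hk) IHn); simpl; lra. }
(* [pr] will be [Re] and then [Im]. The series of increments of each coordinate converges, and it
   telescopes to the coordinate itself. *)
assert (Hlim : forall pr : C -> R, (forall z, Rabs (pr z) <= Cmod z) ->
  (forall z w, pr (z - w)%C = pr z - pr w) ->
  exists l, is_lim_seq (fun n => pr (u n)) (Finite l)).
{ intros pr Hpr Hprm.
  assert (Hex : ex_series (fun n => pr (u (S n)) - pr (u n))).
  { apply (ex_series_le (V := R_CompleteNormedModule) _ (fun n => D * k ^ n)).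
    - intros n; rewrite <- Hprm; eapply Rle_trans; [apply Hpr | apply Hstep].
    - apply (ex_series_scal_l D (fun n => k ^ n)), ex_series_geom.
      rewrite Rabs_pos_eq; lra. }
  destruct Hex as [l Hl].
  exists (l + pr (u 0%nat)).
  apply is_lim_seq_incr_1.
  apply (is_lim_seq_ext
    (fun n => sum_n (fun n => pr (u (S n)) - pr (u n)) n + pr (u 0%nat))).
  - induction n.
    + rewrite sum_O; ring.
    + rewrite sum_Sn; unfold plus; simpl in *; rewrite <- IHn; ring.
  - apply (is_lim_seq_plus' _ _ l (pr (u 0%nat))); [exact Hl | apply is_lim_seq_const]. }
destruct (Hlim Re re_le_Cmod (fun z w => eq_refl)) as [x Hx].
destruct (Hlim Im im_le_Cmod (fun z w => eq_refl)) as [y Hy].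
assert (Hconv : forall eps, 0 < eps -> exists n,
  Cmod (u n - (x, y))%C < eps /\ Cmod (u (S n) - (x, y))%C < eps).
{ intros eps Heps; assert (He : 0 < eps / 2) by lra.
  apply is_lim_seq_spec in Hx; apply is_lim_seq_spec in Hy.
  destruct (Hx (mkposreal _ He)) as [N1 HN1], (Hy (mkposreal _ He)) as [N2 HN2].
  simpl in HN1, HN2.
  assert (Hall : forall n, (N1 + N2 <= n)%nat -> Cmod (u n - (x, y))%C < eps).
  { intros n Hn; eapply Rle_lt_trans; [apply Cmod_le_abs|].
    change (Rabs (Re (u n) - x) + Rabs (Im (u n) - y) < eps).
    generalize (HN1 n ltac:(lia)) (HN2 n ltac:(lia)); lra. }
  exists (N1 + N2)%nat; split; apply Hall; lia. }
assert (Hz : Cmod (x, y) <= r).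
{ apply le_epsilon; intros eps Heps; destruct (Hconv eps Heps) as [n [Hn _]].
  rewrite Cmod_minus_sym in Hn.
  generalize (Cmod_minus_le (x, y) (u n)) (Hu n); lra. }
exists (x, y); split; [exact Hz|].
apply Cmod_minus_0, Rle_antisym; [|apply Cmod_ge_0].
apply le_epsilon; intros eps Heps.
destruct (Hconv (eps / 2) ltac:(lra)) as [n [Hn HSn]].
replace (G (x, y) - (x, y))%C with ((G (x, y) - G (u n)) + (u (S n) - (x, y)))%C
  by (simpl; ring).
eapply Rle_trans; [apply Cmod_triangle|].
assert (Hl := Hlip (x, y) (u n) Hz (Hu n)).
rewrite (Cmod_minus_sym (x, y) (u n)) in Hl.
generalize (Cmod_ge_0 (u n - (x, y))%C); nra.
Qed.

(* The indicator of [P] is locally constant, so it has derivative zero. *)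
Lemma R_connected (P Q : R -> Prop) (a b : R) :
  (forall t, P t \/ Q t) -> (forall t, ~ (P t /\ Q t)) ->
  (forall t, P t -> locally t P) -> (forall t, Q t -> locally t Q) ->
  P a -> ~ Q b.
Proof.
intros Hor Hand HP HQ Ha Hb.
set (phi := fun t => if excluded_middle_informative (P t) then 1 else 0).
assert (HphiP : forall t, P t -> phi t = 1).
{ intros t Ht; unfold phi; destruct excluded_middle_informative; tauto. }
assert (HphiQ : forall t, Q t -> phi t = 0).
{ intros t Ht; unfold phi; destruct excluded_middle_informative; [|reflexivity].
  destruct (Hand t); tauto. }
assert (Hd : forall t, is_derive phi t 0).
{ intros t; destruct (Hor t) as [Ht | Ht].
  - apply (is_derive_ext_loc (fun _ => 1)).
    + apply (filter_imp P); [intros s Hs; symmetry; now apply HphiP | now apply HP].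
    + apply (is_derive_const (V := R_NormedModule)).
  - apply (is_derive_ext_loc (fun _ => 0)).
    + apply (filter_imp Q); [intros s Hs; symmetry; now apply HphiQ | now apply HQ].
    + apply (is_derive_const (V := R_NormedModule)). }
destruct (MVT_gen phi a b (fun _ => 0)) as [c [_ E]].
- intros; apply Hd.
- intros; apply derivable_continuous_pt; eexists; apply is_derive_Reals, Hd.
- rewrite (HphiP a Ha), (HphiQ b Hb) in E; lra.
Qed.

Lemma open_Cmod (U : C -> Prop) (z : C) :
  open U -> U z -> exists d, 0 < d /\ forall w, Cmod (w - z)%C < d -> U w.
Proof.
intros HU Hz; destruct (HU z Hz) as [d Hd].
exists d; split; [apply cond_pos | intros w Hw].
apply Hd; split.
- exact (Rle_lt_trans _ _ _ (re_le_Cmod (w - z)%C) Hw).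
- exact (Rle_lt_trans _ _ _ (im_le_Cmod (w - z)%C) Hw).
Qed.

(** Basic neighbourhoods in [C] are squares. The one of half-side [d / 2] lies in the disc of radius
    [d]. *)
Lemma Cmod_open (U : C -> Prop) :
  (forall z, U z -> exists d, 0 < d /\ forall w, Cmod (w - z)%C < d -> U w) ->
  open U.
Proof.
intros H z Hz; destruct (H z Hz) as [d [Hd Hw]].
assert (Hd2 : 0 < d / 2) by lra.
exists (mkposreal _ Hd2); intros w [H1 H2]; apply Hw.
eapply Rle_lt_trans; [apply Cmod_le_abs|].
change (Rabs (Re w - Re z) < d / 2) in H1.
change (Rabs (Im w - Im z) < d / 2) in H2.
change (Rabs (Re w - Re z) + Rabs (Im w - Im z) < d); lra.
Qed.

(* Solving [f z = w] amounts to finding a fixed point of the contraction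
   [z => Linv (w - (f z - L z))] of the closed disc of radius [r].  The preimage
   of the disc is connected because preimages of a segment in it move
   continuously: [f] expands distances by at least [a0 - B r]. *)
Lemma perturbation_schlicht (f L Linv : C -> C) (B beta : R -> R) (rho a0 A Rad : R) :
  0 < a0 -> 0 < Rad -> L (RtoC 0) = RtoC 0 ->
  (forall w, L (Linv w) = w) ->
  (forall z w, a0 * Cmod (z - w)%C <= Cmod (L z - L w)%C <= A * Cmod (z - w)%C) ->
  (forall r, 0 <= r < rho -> 0 <= B r < a0) ->
  (forall r z w, 0 <= r < rho -> Cmod z <= r -> Cmod w <= r ->
    Cmod ((f z - L z) - (f w - L w))%C <= B r * Cmod (z - w)%C) ->
  (forall r z, 0 <= r < rho -> Cmod z <= r -> Cmod (f z - L z)%C <= beta r) ->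
  (forall m, 0 <= m < Rad -> exists r, 0 <= r < rho /\ m + beta r <= a0 * r) ->
  univalent_on (open_disc (RtoC 0) rho) f /\
  has_schlicht_disc (open_disc (RtoC 0) rho) f Rad.
Proof.
intros Ha0 HRad HL0 HLinv HL HB HE Hbeta HR.
assert (Hexp : forall r z w, 0 <= r < rho -> Cmod z <= r -> Cmod w <= r ->
  (a0 - B r) * Cmod (z - w)%C <= Cmod (f z - f w)%C).
{ intros r z w Hr Hz Hw.
  assert (H := Cmod_minus_le (L z - L w)%C (- ((f z - L z) - (f w - L w)))%C).
  rewrite Cmod_opp in H.
  replace (L z - L w - - ((f z - L z) - (f w - L w)))%C with (f z - f w)%C in H by ring.
  generalize (HE r z w Hr Hz Hw) (HL z w); nra. }
assert (Huniv : univalent_on (open_disc (RtoC 0) rho) f).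
{ intros z w Hz Hw Efw; apply open_disc_0_elim in Hz; apply open_disc_0_elim in Hw.
  apply Cmod_minus_0.
  set (r := Rmax (Cmod z) (Cmod w)).
  assert (Hr : 0 <= r < rho).
  { split; [exact (Rle_trans _ _ _ (Cmod_ge_0 z) (Rmax_l _ _)) | now apply Rmax_lub_lt]. }
  assert (H := Hexp r z w Hr (Rmax_l _ _) (Rmax_r _ _)).
  replace (f z - f w)%C with (RtoC 0) in H by (rewrite Efw; ring).
  rewrite Cmod_0 in H.
  generalize (HB r Hr) (Cmod_ge_0 (z - w)%C); nra. }
split; [exact Huniv|].
assert (Hsolve : forall m r w, 0 <= r < rho -> m + beta r <= a0 * r -> Cmod w <= m ->
  exists z, Cmod z <= r /\ f z = w).
{ intros m r w Hr Hm Hw.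
  assert (Hinv : forall z w, a0 * Cmod (Linv z - Linv w)%C <= Cmod (z - w)%C).
  { intros z w'; rewrite <- (HLinv z) at 2; rewrite <- (HLinv w') at 2; apply HL. }
  assert (Hinv0 : Linv (RtoC 0) = RtoC 0).
  { apply Cmod_minus_0.
    generalize (proj1 (HL (Linv (RtoC 0)) (RtoC 0))) (Cmod_ge_0 (Linv (RtoC 0) - RtoC 0)%C).
    rewrite HLinv, HL0; replace (RtoC 0 - RtoC 0)%C with (RtoC 0) by ring.
    rewrite Cmod_0; nra. }
  destruct (banach_disc (fun z => Linv (w - (f z - L z))%C) r (B r / a0)) as [z [Hz Ez]].
  - apply Hr.
  - destruct (HB r Hr) as [H1 H2].
    split; [apply Rmult_le_pos; [lra | left; now apply Rinv_0_lt_compat]|].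
    apply (Rmult_lt_reg_r a0); [assumption|].
    unfold Rdiv; rewrite Rmult_assoc, Rinv_l; lra.
  (* The condition [m + beta r <= a0 * r] says exactly that the iteration maps the closed disc of
     radius [r] into itself, since [Linv] contracts by [1 / a0]. *)
  - intros z Hz; apply (Rmult_le_reg_l a0); [assumption|].
    assert (H := Hinv (w - (f z - L z))%C (RtoC 0)).
    rewrite Hinv0 in H.
    replace (Linv (w - (f z - L z)) - RtoC 0)%C with (Linv (w - (f z - L z))%C) in H by ring.
    replace (w - (f z - L z) - RtoC 0)%C with (w + - (f z - L z))%C in H by ring.
    generalize (Cmod_triangle w (- (f z - L z))%C); rewrite Cmod_opp.
    generalize (Hbeta r z Hr Hz); lra.
  - intros z1 z2 H1 H2; apply (Rmult_le_reg_l a0); [assumption|].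
    eapply Rle_trans; [apply Hinv|].
    replace (w - (f z1 - L z1) - (w - (f z2 - L z2)))%C
      with (- ((f z1 - L z1) - (f z2 - L z2)))%C by ring.
    rewrite Cmod_opp; eapply Rle_trans; [apply (HE r); assumption|].
    right; field; lra.
  - exists z; split; [exact Hz|].
    assert (E := HLinv (w - (f z - L z))%C).
    rewrite Ez in E.
    transitivity (L z + (f z - L z))%C; [ring|].
    rewrite E at 1; ring. }
(* The subdomain is the full preimage of the target disc inside the disc of radius [rho].
   Solvability makes [f] map it onto the target, so openness and connectedness of [T] are the
   substantial points left. *)
set (T := fun z => Cmod z < rho /\ Cmod (f z) < Rad).
assert (Hsol : forall w, Cmod w < Rad -> exists z, T z /\ f z = w).
{ intros w Hw.
  destruct (HR (Cmod w) (conj (Cmod_ge_0 w) Hw)) as [r [Hr Hm]].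
  destruct (Hsolve _ r w Hr Hm (Rle_refl _)) as [z [Hz Ez]].
  exists z; repeat split; [lra | now rewrite Ez | exact Ez]. }
exists (RtoC 0), T; split; [split; [|split]|split; [|split]].
- apply Cmod_open; intros z [Hz Hfz].
  assert (HA : a0 <= A).
  { generalize (HL (RtoC 1) (RtoC 0)).
    replace (RtoC 1 - RtoC 0)%C with (RtoC 1) by ring; rewrite Cmod_1; lra. }
  (* The first bound keeps [w] in the disc of radius [rho]. For the second, [L] has Lipschitz
     constant [A] and the perturbation one below [a0], so [f w] moves by at most
     [(A + a0) * Cmod (w - z)]. *)
  exists (Rmin (rho - Cmod z) ((Rad - Cmod (f z)) / (A + a0))); split.
  { apply Rmin_pos; [lra | apply Rdiv_lt_0_compat; lra]. }
  intros w Hw.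
  assert (H1 := Rlt_le_trans _ _ _ Hw (Rmin_l _ _)).
  assert (H2 := Rlt_le_trans _ _ _ Hw (Rmin_r _ _)).
  assert (Hwr : Cmod w < rho) by (generalize (Cmod_minus_le w z); lra).
  split; [exact Hwr|].
  assert (Hr : 0 <= Rmax (Cmod w) (Cmod z) < rho).
  { split; [exact (Rle_trans _ _ _ (Cmod_ge_0 w) (Rmax_l _ _)) | now apply Rmax_lub_lt]. }
  assert (H3 := HE _ w z Hr (Rmax_l _ _) (Rmax_r _ _)).
  assert (H4 := Cmod_triangle (L w - L z) ((f w - L w) - (f z - L z))).
  replace (L w - L z + ((f w - L w) - (f z - L z)))%C with (f w - f z)%C in H4 by ring.
  assert (H5 := HB _ Hr).
  assert (H6 := HL w z).
  assert (H7 := Cmod_ge_0 (w - z)%C).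
  assert (H8 : Cmod (w - z)%C * (A + a0) < Rad - Cmod (f z)).
  { apply (Rmult_lt_reg_r (/ (A + a0))); [apply Rinv_0_lt_compat; lra|].
    rewrite Rmult_assoc, Rinv_r, Rmult_1_r by lra; exact H2. }
  generalize (Cmod_minus_le (f w) (f z)); nra.
- intros U V HU HV Hcov [z1 [[Hz1 Hf1] HU1]] [z2 [[Hz2 Hf2] HV2]].
  apply NNPP; intros Hno.
  (* The segment joining the two values stays in the closed disc of radius [m], so a single radius
     [r < rho] serves for solving along all of it. *)
  set (m := Rmax (Cmod (f z1)) (Cmod (f z2))).
  assert (Hm : 0 <= m < Rad).
  { split; [exact (Rle_trans _ _ _ (Cmod_ge_0 _) (Rmax_l _ _)) | now apply Rmax_lub_lt]. }
  destruct (HR m Hm) as [r [Hr Hmr]].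
  (* The weight $\sin^2 t$ keeps [w t] on the segment for every real [t], so [R_connected] applies
     on the whole line. The endpoints are reached at [0] and [PI / 2]. *)
  set (w := fun t => (f z1 + RtoC (Rsqr (sin t)) * (f z2 - f z1))%C).
  assert (Hw : forall t, Cmod (w t) <= m).
  { intros t; unfold w.
    replace (f z1 + _)%C with (RtoC (Rsqr (cos t)) * f z1 + RtoC (Rsqr (sin t)) * f z2)%C
      by (rewrite cos2, RtoC_minus; ring).
    eapply Rle_trans; [apply Cmod_triangle|].
    rewrite !Cmod_mult, !Cmod_R, !Rabs_pos_eq by apply Rle_0_sqr.
    generalize (Rmax_l (Cmod (f z1)) (Cmod (f z2))) (Rmax_r (Cmod (f z1)) (Cmod (f z2))).
    fold m; intros A1 A2.
    generalize (Rle_0_sqr (sin t)) (Rle_0_sqr (cos t)) (sin2_cos2 t); nra. }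
  assert (HT : forall z t, Cmod z <= r -> f z = w t -> T z).
  { intros z t Hz Ez; split; [|rewrite Ez; generalize (Hw t)]; lra. }
  set (P := fun (U : C -> Prop) t => exists z, Cmod z <= r /\ f z = w t /\ U z).
  assert (Hc := HB r Hr).
  assert (Hopen : forall W t, open W -> P W t -> locally t (P W)).
  { intros W t HW [z [Hz [Ez HWz]]].
    destruct (open_Cmod W z HW HWz) as [d [Hd HdW]].
    set (D := Cmod (f z2 - f z1)%C).
    assert (HD : 0 <= D) by apply Cmod_ge_0.
    (* This tolerance on the weight moves [w] by less than [(a0 - B r) * d], hence its preimage by
       less than [d]. The [+ 1] covers the case [f z1 = f z2], where [D = 0]. *)
    assert (He : 0 < (a0 - B r) * d / (D + 1)).
    { apply Rdiv_lt_0_compat; [apply Rmult_lt_0_compat; lra | lra]. }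
    assert (Hsin : continuous (fun s => Rsqr (sin s)) t).
    { apply (ex_derive_continuous (fun s => Rsqr (sin s))); unfold Rsqr; auto_derive; auto. }
    generalize (proj1 (filterlim_locally _ _) Hsin (mkposreal _ He)).
    apply filter_imp; intros s Hs.
    change (Rabs (Rsqr (sin s) - Rsqr (sin t)) < (a0 - B r) * d / (D + 1)) in Hs.
    destruct (Hsolve m r (w s) Hr Hmr (Hw s)) as [z' [Hz' Ez']].
    exists z'; split; [exact Hz'|split; [exact Ez'|]].
    apply HdW.
    apply (Rmult_lt_reg_l (a0 - B r)); [lra|].
    eapply Rle_lt_trans; [apply (Hexp r); assumption|].
    rewrite Ez, Ez'; unfold w.
    replace (_ - _)%C with (RtoC (Rsqr (sin s) - Rsqr (sin t)) * (f z2 - f z1))%C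
      by (rewrite RtoC_minus; ring).
    rewrite Cmod_mult, Cmod_R; fold D.
    apply (Rmult_lt_compat_r (D + 1)) in Hs; [|lra].
    unfold Rdiv in Hs; rewrite Rmult_assoc, Rinv_l, Rmult_1_r in Hs by lra.
    generalize (Rabs_pos (Rsqr (sin s) - Rsqr (sin t))); nra. }
  (* A point of [T] is only known to lie in the disc of radius [rho]. By injectivity it is the
     solution already found in the closed disc of radius [r]. *)
  assert (Hend : forall W z t, T z -> f z = w t -> W z -> P W t).
  { intros W z t [Hz _] Ez HWz.
    destruct (Hsolve m r (w t) Hr Hmr (Hw t)) as [z' [Hz' Ez']].
    exists z; repeat split; [|exact Ez | exact HWz].
    rewrite (Huniv z z'); [exact Hz' | now apply open_disc_0_intro
      | apply open_disc_0_intro; lra | now rewrite Ez, Ez']. }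
  refine (R_connected (P U) (P V) 0 (PI / 2) _ _ (fun t => Hopen U t HU)
    (fun t => Hopen V t HV) _ _).
  + intros t; destruct (Hsolve m r (w t) Hr Hmr (Hw t)) as [z [Hz Ez]].
    destruct (Hcov z (HT z t Hz Ez)); [left | right]; now exists z.
  + intros t [[z [Hz [Ez HUz]]] [z' [Hz' [Ez' HVz]]]].
    apply Hno; exists z; split; [exact (HT z t Hz Ez)|split; [exact HUz|]].
    rewrite (Huniv z z'); [exact HVz | apply open_disc_0_intro; lra
      | apply open_disc_0_intro; lra | now rewrite Ez, Ez'].
  + apply (Hend U z1); [now split| |exact HU1].
    unfold w; rewrite sin_0, Rsqr_0; ring.
  + apply (Hend V z2); [now split| |exact HV2].
    unfold w; rewrite sin_PI2, Rsqr_1; ring.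
- destruct (Hsol (RtoC 0)) as [z [Hz _]]; [now rewrite Cmod_0 | now exists z].
- intros z [Hz _]; now apply open_disc_0_intro.
- intros z w [Hz _] [Hw _]; apply Huniv; now apply open_disc_0_intro.
- intros w; split.
  + intros Hw; apply Hsol; now apply open_disc_0_elim.
  + intros [z [[_ Hz] <-]]; now apply open_disc_0_intro.
Qed.

(** * The differential at 0 and the radius of the schlicht disc *)

Lemma linear_part_bounds (f : C -> C) (z w : C) :
  (Cmod (d_z f (RtoC 0)) - Cmod (d_zbar f (RtoC 0))) * Cmod (z - w)%C
    <= Cmod (linear_part f z - linear_part f w)%C
    <= Lambda_ f (RtoC 0) * Cmod (z - w)%C.
Proof.
set (p := d_z f (RtoC 0)); set (q := d_zbar f (RtoC 0)).
replace (linear_part f z - linear_part f w)%C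
  with (p * (z - w) - - (q * Cconj (z - w)))%C
  by (unfold linear_part; fold p q; rewrite Cminus_conj; ring).
split.
- eapply Rle_trans; [|apply Cmod_minus_le].
  rewrite Cmod_opp, !Cmod_mult, Cmod_conj; right; ring.
- replace (p * (z - w) - - (q * Cconj (z - w)))%C
    with (p * (z - w) + q * Cconj (z - w))%C by ring.
  eapply Rle_trans; [apply Cmod_triangle|].
  rewrite !Cmod_mult, Cmod_conj; unfold Lambda_; fold p q; right; ring.
Qed.

(** The inverse of $w\mapsto pw+q\bar w$ has denominator $|p|^2-|q|^2$, which the normalisation
    [J_ f 0 = 1] makes equal to 1. *)
Definition linear_part_inv (f : C -> C) (w : C) : C :=
  (Cconj (d_z f (RtoC 0)) * w - d_zbar f (RtoC 0) * Cconj w)%C.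

Lemma linear_part_invK (f : C -> C) (w : C) :
  J_ f (RtoC 0) = 1 -> linear_part f (linear_part_inv f w) = w.
Proof.
unfold linear_part, linear_part_inv, J_.
set (p := d_z f (RtoC 0)); set (q := d_zbar f (RtoC 0)); intros HJ.
assert (HJC : (p * Cconj p - q * Cconj q)%C = RtoC 1).
{ rewrite <- !Cmod2_conj, <- RtoC_minus; now rewrite HJ. }
rewrite Cminus_conj, !Cmult_conj, !Cconj_conj.
transitivity ((p * Cconj p - q * Cconj q) * w)%C; [ring|].
rewrite HJC; ring.
Qed.

(* [radius_profile a0 M r] is the integral of [a0 - M t / (1 - t)] over [0, r]. *)
Definition radius_profile (a0 M r : R) : R := a0 * r + M * (r + ln (1 - r)).

Lemma radius_profile_derive (a0 M r : R) :
  r < 1 -> is_derive (radius_profile a0 M) r (a0 - M * r / (1 - r)).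
Proof. intros Hr; unfold radius_profile; auto_derive; [lra | field; lra]. Qed.

(** The value [a0 / (a0 + M)] is the root of $Mr/(1-r)=a_0$. Below it the deviation's Lipschitz
    constant stays under the expansion factor [a0]. *)
Lemma slope_pos (a0 M r : R) :
  0 < a0 -> 0 <= M -> 0 <= r < a0 / (a0 + M) -> 0 <= M * r / (1 - r) < a0.
Proof.
intros Ha HM [Hr0 Hr].
assert (H : r * (a0 + M) < a0).
{ apply (Rmult_lt_compat_r (a0 + M)) in Hr; [|lra].
  unfold Rdiv in Hr; rewrite Rmult_assoc, Rinv_l in Hr; lra. }
assert (Hr1 : r < 1) by nra.
split.
- apply Rmult_le_pos; [now apply Rmult_le_pos | left; apply Rinv_0_lt_compat; lra].
- apply (Rmult_lt_reg_r (1 - r)); [lra|].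
  unfold Rdiv; rewrite Rmult_assoc, Rinv_l; lra.
Qed.

Lemma radius_profile_pos (a0 M : R) :
  0 < a0 -> 0 < M -> 0 < radius_profile a0 M (a0 / (a0 + M)).
Proof.
intros Ha HM; set (rho := a0 / (a0 + M)).
assert (Hrho : 0 < rho) by (apply Rdiv_lt_0_compat; lra).
assert (Hrho1 : rho < 1).
{ apply (Rmult_lt_reg_r (a0 + M)); [lra|]; unfold rho, Rdiv.
  rewrite Rmult_assoc, Rinv_l; lra. }
destruct (MVT_cor2 (radius_profile a0 M) (fun r => a0 - M * r / (1 - r)) 0 rho Hrho)
  as [c [E Hc]].
{ intros c Hc; apply is_derive_Reals, radius_profile_derive; lra. }
assert (Hs := slope_pos a0 M c Ha (Rlt_le _ _ HM) ltac:(fold rho; lra)).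
assert (E0 : radius_profile a0 M 0 = 0).
{ unfold radius_profile; rewrite Rminus_0_r, ln_1; ring. }
rewrite E0 in E; nra.
Qed.

(** A strict inequality at the endpoint persists slightly to its left, by continuity. The radius
    must be strictly smaller, since at the endpoint the contraction factor becomes 1. *)
Lemma radius_profile_reach (a0 M m : R) :
  0 < a0 -> 0 < M -> m < radius_profile a0 M (a0 / (a0 + M)) ->
  exists r, 0 <= r < a0 / (a0 + M) /\ m <= radius_profile a0 M r.
Proof.
intros Ha HM Hm; set (rho := a0 / (a0 + M)) in *.
assert (Hrho : 0 < rho) by (apply Rdiv_lt_0_compat; lra).
assert (Hrho1 : rho < 1).
{ apply (Rmult_lt_reg_r (a0 + M)); [lra|]; unfold rho, Rdiv.
  rewrite Rmult_assoc, Rinv_l; lra. }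
assert (Hcont : continuous (radius_profile a0 M) rho).
{ apply (ex_derive_continuous (radius_profile a0 M)).
  eexists; now apply radius_profile_derive. }
assert (He : 0 < radius_profile a0 M rho - m) by lra.
destruct (proj1 (filterlim_locally _ _) Hcont (mkposreal _ He)) as [d Hd].
set (e := Rmin (d / 2) rho).
assert (Hde : 0 < e) by (apply Rmin_pos; [generalize (cond_pos d)|]; lra).
exists (rho - e); split; [generalize (Rmin_r (d / 2) rho); fold e; lra|].
assert (Hb : ball rho d (rho - e)).
{ change (Rabs (rho - e - rho) < d).
  rewrite Rabs_minus_sym, Rabs_pos_eq by lra.
  generalize (Rmin_l (d / 2) rho) (cond_pos d); fold e; lra. }
specialize (Hd _ Hb).
change (Rabs (radius_profile a0 M (rho - e) - radius_profile a0 M rho)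
  < radius_profile a0 M rho - m) in Hd.
apply Rabs_def2 in Hd; lra.
Qed.

Lemma harmonic_schlicht (f : C -> C) (M a0 : R) :
  harmonic_on (open_disc (RtoC 0) 1) f ->
  (forall z, open_disc (RtoC 0) 1 z -> Lambda_ f z <= M) ->
  f (RtoC 0) = RtoC 0 -> J_ f (RtoC 0) = 1 -> 0 < a0 -> 0 < M ->
  a0 <= Cmod (d_z f (RtoC 0)) - Cmod (d_zbar f (RtoC 0)) ->
  univalent_on (open_disc (RtoC 0) (a0 / (a0 + M))) f /\
  has_schlicht_disc (open_disc (RtoC 0) (a0 / (a0 + M))) f
    (radius_profile a0 M (a0 / (a0 + M))).
Proof.
intros Hf HM Hf0 HJ Ha HM0 Hlow.
assert (Hrho1 : a0 / (a0 + M) < 1).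
{ apply (Rmult_lt_reg_r (a0 + M)); [lra|]; unfold Rdiv.
  rewrite Rmult_assoc, Rinv_l; lra. }
apply (perturbation_schlicht f (linear_part f) (linear_part_inv f)
  (fun r => M * r / (1 - r)) (fun r => M * (- r - ln (1 - r)))
  (a0 / (a0 + M)) a0 (Lambda_ f (RtoC 0))).
- exact Ha.
- now apply radius_profile_pos.
- unfold linear_part.
  replace (Cconj (RtoC 0)) with (RtoC 0)
    by (unfold Cconj, RtoC; simpl; now rewrite Ropp_0).
  ring.
- intros w; now apply linear_part_invK.
- intros z w; destruct (linear_part_bounds f z w) as [H1 H2].
  split; [|exact H2].
  eapply Rle_trans; [|exact H1].
  apply Rmult_le_compat_r; [apply Cmod_ge_0 | exact Hlow].
- intros r Hr; apply slope_pos; lra.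
- intros r z w Hr Hz Hw; apply deviation_lipschitz; (assumption || lra).
- intros r z Hr Hz.
  eapply Rle_trans; [apply (deviation_bound f M z); (assumption || lra)|].
  apply Rmult_le_compat_l; [lra|].
  (* The bound just obtained is at [Cmod z]. It passes to the larger [r] because $-x-\ln(1-x)$ has
     the nonnegative derivative $x/(1-x)$ on $[0,1)$. *)
  destruct (MVT_gen (fun r => - r - ln (1 - r)) (Cmod z) r (fun r => r / (1 - r)))
    as [c [Hc E]].
  + intros x; rewrite Rmax_right by assumption; intros Hx; auto_derive; [lra | field; lra].
  + intros x; rewrite Rmax_right by assumption; intros Hx.
    apply derivable_continuous_pt; exists (x / (1 - x)); apply is_derive_Reals.
    auto_derive; [lra | field; lra].
  + rewrite Rmin_left, Rmax_right in Hc by assumption.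
    assert (0 <= c / (1 - c)).
    { apply Rmult_le_pos; [generalize (Cmod_ge_0 z)
      | left; apply Rinv_0_lt_compat]; lra. }
    nra.
- intros m Hm; destruct (radius_profile_reach a0 M m Ha HM0 (proj2 Hm)) as [r [Hr Hmr]].
  exists r; split; [exact Hr|]; unfold radius_profile in Hmr; lra.
Qed.

(** * Quasiregularity and the explicit constants *)

(** Positivity of the Jacobian gives $|f_{\bar z}|<|f_z|$, so $J_f=\Lambda_f\lambda_f$, and a
    positive factor $\Lambda_f$ cancels from $\Lambda_f^2\le KJ_f$. *)
Lemma quasiregular_Lambda (S : C -> Prop) (K : R) (f : C -> C) (z : C) :
  harmonic_quasiregular_on S K f -> S z ->
  lambda_ f z = Cmod (d_z f z) - Cmod (d_zbar f z) /\ Lambda_ f z <= K * lambda_ f z.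
Proof.
intros [[_ HJ] HK] Hz; specialize (HJ z Hz); specialize (HK z Hz).
unfold lambda_, Lambda_, J_ in *.
assert (H1 := Cmod_ge_0 (d_z f z)); assert (H2 := Cmod_ge_0 (d_zbar f z)).
set (p := Cmod (d_z f z)) in *; set (q := Cmod (d_zbar f z)) in *.
assert (q < p) by nra.
rewrite Rabs_pos_eq by lra; split; [reflexivity | nra].
Qed.

Theorem theorem2p7 (K lam : R) (f h g : C -> C)
  (HK : 1 <= K)
  (Hh : analytic_on (open_disc (RtoC 0) 1) h)
  (Hg : analytic_on (open_disc (RtoC 0) 1) g)
  (Hf : forall z : C, open_disc (RtoC 0) 1 z -> f z = (h z + Cconj (g z))%C)
  (Hqr : harmonic_quasiregular_on (open_disc (RtoC 0) 1) K f)
  (Hf0 : f (RtoC 0) = RtoC 0)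
  (HJ0 : J_ f (RtoC 0) = 1)
  (Hlam : forall z : C, open_disc (RtoC 0) 1 z -> lambda_ f z <= lam) :
  let rho := 1 / (1 + lam * Rpower K (3 / 2)) in
  let Rad := rho / sqrt K
             + K * lam * (rho + ln (lam * Rpower K (3 / 2) * rho)) in
  univalent_on (open_disc (RtoC 0) rho) f /\
  has_schlicht_disc (open_disc (RtoC 0) rho) f Rad.
Proof.
intros rho Rad.
assert (H00 : open_disc (RtoC 0) 1 (RtoC 0))
  by (apply open_disc_0_intro; rewrite Cmod_0; lra).
set (k := sqrt K).
assert (Hk : 0 < k) by (apply sqrt_lt_R0; lra).
assert (Hkk : k * k = K) by (apply sqrt_sqrt; lra).
assert (HKp : Rpower K (3 / 2) = K * k).
{ replace (3 / 2) with (1 + / 2) by lra.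
  rewrite Rpower_plus, Rpower_1, Rpower_sqrt by lra; reflexivity. }
destruct (quasiregular_Lambda _ _ _ _ Hqr H00) as [El _].
(* At 0 quasiregularity reads $(p+q)^2\le K$, so $p+q\le k$. With $(p+q)(p-q)=1$ this gives $p-q\ge
   1/k$. *)
assert (Hlow : / k <= Cmod (d_z f (RtoC 0)) - Cmod (d_zbar f (RtoC 0))).
{ assert (HKJ := proj2 Hqr _ H00); rewrite HJ0 in HKJ.
  unfold J_, Lambda_ in *.
  assert (H1 := Cmod_ge_0 (d_z f (RtoC 0))); assert (H2 := Cmod_ge_0 (d_zbar f (RtoC 0))).
  set (p := Cmod (d_z f (RtoC 0))) in *; set (q := Cmod (d_zbar f (RtoC 0))) in *.
  assert (p + q <= k) by nra.
  assert (q < p) by nra.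
  apply (Rmult_le_reg_l k); [exact Hk|]; rewrite Rinv_r by lra; nra. }
assert (Hk' : 0 < / k) by now apply Rinv_0_lt_compat.
assert (Hlam0 : 0 < lam) by (generalize (Hlam _ H00); lra).
set (M := K * lam).
assert (HM : 0 < M) by (apply Rmult_lt_0_compat; lra).
assert (Hden : 0 < 1 + M * k) by (generalize (Rmult_lt_0_compat _ _ HM Hk); lra).
assert (Erho : rho = / k / (/ k + M)).
{ unfold rho; rewrite HKp; unfold M in *; field; nra. }
assert (ERad : Rad = radius_profile (/ k) M rho).
{ unfold Rad, radius_profile; fold k M.
  (* From $\rho\,(1+\lambda K^{3/2})=1$ the argument of the logarithm is $1-\rho$, as in
     [radius_profile]. *)
  replace (lam * Rpower K (3 / 2) * rho) with (1 - rho).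
  - unfold Rdiv; ring.
  - unfold rho; rewrite HKp; unfold M in *; field; nra. }
rewrite ERad, Erho.
apply harmonic_schlicht; [exact (proj1 (proj1 Hqr)) | | exact Hf0 | exact HJ0
  | exact Hk' | exact HM | exact Hlow].
intros z Hz.
destruct (quasiregular_Lambda _ _ _ _ Hqr Hz) as [_ H].
eapply Rle_trans; [exact H|].
apply Rmult_le_compat_l; [lra | now apply Hlam].
Qed.
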